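(* Let $(p/q,\ell)$ be one of the pairs (root fraction, odd prime) in the table given in the context, write $q=ap+r$ with $0<r<p$, let $k,j$ be non-negative integers, where $j=0$ is required if the pair is marked with ( * ), and let $$\frac{p'}{q'}=\frac{p+2\ell jr}{q+2\ell(kp+jar+2\ell jkr)}.$$ Let $\alpha=\alpha_k=\frac{t^{2\ell k}-1}{t^{2\ell}-1}$ and let $f(t)$ be the Laurent polynomial listed for $(p/q,\ell)$ in the table. Then the $\ell$-twisted Alexander polynomial of $K_{p'/q'}$ is of the form $$\tilde\Delta^\ell_{p'/q'}(t)\doteq\frac{\Delta_{K_{p'/q'}}(t)}{t-1}f(t)f(-t),$$ where $\doteq$ denotes equality up to a factor $\pm t^{m\ell}$, $m\in\mathbb Z$. Moreover, $$f(t)\equiv\left(\frac{\Delta_{K_{p'/q'}}(t)}{t+1}\right)^{\frac{\ell-1}{2}}\pmod\ell .$$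
   Context: For odd coprime integers $0<p<q$, $K_{p/q}$ is the corresponding 2-bridge knot and $\epsilon_i=(-1)^{\lfloor ip/q\rfloor}$. The Alexander polynomial is taken in the canonical form $\Delta_{K_{p/q}}(t)=1-t^{\epsilon_1}+t^{\epsilon_1+\epsilon_2}-\dots+t^{\epsilon_1+\dots+\epsilon_{q-1}}$. For an odd prime $\ell\mid q$ the $\ell$-twisted Alexander polynomial is defined as follows. The knot group is $G_{p/q}=\langle a,b\mid aw=wb\rangle$ with $w=b^{\epsilon_1}a^{\epsilon_2}b^{\epsilon_3}\cdots a^{\epsilon_{q-1}}$. The dihedral group is $D_\ell=\langle x,y\mid x^2=1,\ y^\ell=1,\ yx=xy^{-1}\rangle$. Fix $\pi:D_\ell\to GL(\ell,\mathbb C)$ with $\pi(x)=F$, the matrix with ones on the antidiagonal and zeros elsewhere, and $\pi(y)=R$, the matrix with ones in positions $(1,\ell)$ and $(i+1,i)$, $1\le i<\ell$, and zeros elsewhere. Let $\rho:G_{p/q}\to D_\ell$ be any surjective homomorphism and $\phi=\pi\circ\rho$. With $\partial w/\partial a$ the Fox derivative, let $$\hat A_\phi=I+(t\phi(a)-I)\left.\frac{\partial w}{\partial a}\right|_{a=t\phi(a),\,b=t\phi(b)}$$ (the group ring element $1$ is replaced by the identity matrix). Then $\tilde\Delta^\ell_{p/q}(t)=\det\hat A_\phi/\det(t\phi(b)-I)$, considered up to factors $\pm t^{m\ell}$; up to such factors it does not depend on $\rho$. (In the claim, $a$ denotes the integer quotient in $q=ap+r$, not the group generator.) TABLE of $f(t)$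 (with $\alpha=\alpha_k$; ( * ) marks pairs for which $j=0$ is required). $\ell=3$: $5/9$: $t^{-1}(t+1)(t^{6}\alpha-t^{3}\alpha+1)$ $5/21$: $t(t+1)(t^{6}\alpha-t^{3}\alpha+1)$ $5/27$: $-(t+1)\big[(t^{10}-t^{9}-t^{8}-t^{7}+t^{6}+t^{5})\alpha+t^{4}-t^{3}-t^{2}-t+1\big]$ $5/33$ ( * ): $t^{-2}(t+1)\big[(t^{12}+t^{11}-t^{10}-t^{9}-t^{8}+t^{7})\alpha+t^{6}+t^{5}-t^{4}-t^{3}-t^{2}+t+1\big]$ $7/9$: $t^{-1}(t+1)\big[(t^{6}+t^{5}-t^{4}-t^{3}-t^{2}+t)\alpha+1\big]$ $7/15$: $(t+1)(t^{6}\alpha-t^{3}\alpha+1)$ $7/27$ ( * ): $(t+1)(t^{6}\alpha-t^{3}\alpha+1)$ $7/33$: $-t^{-1}(t+1)\big[(t^{10}-t^{9}-t^{8}-t^{7}+t^{6}+t^{5})\alpha+t^{4}-t^{3}-t^{2}-t+1\big]$ $7/39$: $-t^{-3}(t+1)\big[(t^{12}+t^{11}-t^{10}-3t^{9}-t^{8}+t^{7}+2t^{6})\alpha+t^{6}+t^{5}-t^{4}-3t^{3}-t^{2}+t+1\big]$ $7/45$ ( * ): $(t+1)\big[(2t^{12}+t^{11}-t^{10}-3t^{9}-t^{8}+t^{7}+t^{6})\alpha+2t^{6}+t^{5}-t^{4}-3t^{3}-t^{2}+t+2\big]$ $\ell=5$: $3/5$: $t^{-2}(t+1)\big[(t^{20}-t^{18}+t^{17}-t^{16}-t^{14}+2t^{13}-2t^{12}+2t^{11}-3t^{10}+2t^{9}-t^{8}+t^{7}-t^{6}+2t^{5}-t^{4})\alpha^2+(2t^{10}-t^{8}+t^{7}-2t^{5}+t^{3}-t^{2})\alpha+1\big]$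 $3/25$: $-(t+1)\big[(t^{32}-2t^{31}+t^{30}-t^{29}+t^{28}-2t^{27}+3t^{26}-2t^{25}+2t^{24}-2t^{23}+t^{22}+t^{20}-t^{19}+t^{18}-t^{16})\alpha^2+(2t^{22}-4t^{21}+2t^{20}-2t^{19}+2t^{18}-4t^{17}+6t^{16}-4t^{15}+3t^{14}-3t^{13}+2t^{12}-2t^{11}+2t^{10}-t^{9}+t^{8})\alpha+t^{12}-2t^{11}+t^{10}-t^{9}+t^{8}-2t^{7}+3t^{6}-2t^{5}+t^{4}-t^{3}+t^{2}-2t+1\big]$ $7/15$: $(t+1)\big[(t^{20}-t^{18}+t^{17}-t^{16}-t^{14}+2t^{13}-2t^{12}+2t^{11}-3t^{10}+2t^{9}-t^{8}+t^{7}-t^{6}+2t^{5}-t^{4})\alpha^2+(2t^{10}-t^{8}+t^{7}-2t^{5}+t^{3}-t^{2})\alpha+1\big]$ $7/25$: $t^{-6}(t+1)\big[(t^{28}-2t^{26}+2t^{24}-t^{23}-t^{22}+3t^{21}-t^{20}-t^{19}-2t^{18}+2t^{17}+2t^{15}-4t^{14}+3t^{13}-t^{12}-t^{11}-t^{10}+3t^{9}-t^{8})\alpha^2+(2t^{18}-4t^{16}+5t^{14}-t^{13}-3t^{12}+3t^{11}+t^{10}-4t^{9}-t^{8}+3t^{7}+t^{6}-t^{5}-t^{4})\alpha+t^{8}-2t^{6}+3t^{4}-2t^{2}+1\big]$ $7/45$: $-(t+1)\big[(t^{32}-3t^{31}+t^{30}+t^{29}+t^{28}-3t^{27}+4t^{26}-2t^{25}-2t^{23}+2t^{22}+t^{21}+t^{20}-3t^{19}+t^{18}+t^{17}-2t^{16}+2t^{14}-t^{12})\alpha^2+(2t^{22}-6t^{21}+2t^{20}+2t^{19}+2t^{18}-6t^{17}+7t^{16}-5t^{15}+t^{14}-t^{13}+3t^{12}-2t^{11}+3t^{10}-3t^{9}-t^{8}+t^{7}+t^{6})\alpha+t^{12}-3t^{11}+t^{10}+t^{9}+t^{8}-3t^{7}+3t^{6}-3t^{5}+t^{4}+t^{3}+t^{2}-3t+1\big]$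 $7/55$: $-t^{-2}(t+1)\big[(t^{32}-2t^{31}+t^{30}-t^{29}+t^{28}-2t^{27}+3t^{26}-2t^{25}+2t^{24}-2t^{23}+t^{22}+t^{20}-t^{19}+t^{18}-t^{16})\alpha^2+(2t^{22}-4t^{21}+2t^{20}-2t^{19}+2t^{18}-4t^{17}+6t^{16}-4t^{15}+3t^{14}-3t^{13}+2t^{12}-2t^{11}+2t^{10}-t^{9}+t^{8})\alpha+t^{12}-2t^{11}+t^{10}-t^{9}+t^{8}-2t^{7}+3t^{6}-2t^{5}+t^{4}-t^{3}+t^{2}-2t+1\big]$ $7/65$: $-t^{-2}(t+1)\big[(t^{36}-2t^{33}+t^{32}-2t^{31}+t^{30}-t^{29}+3t^{28}-2t^{27}+t^{26}-2t^{25}+2t^{24}+t^{22}+t^{20}-t^{19}-t^{18})\alpha^2+(2t^{26}-4t^{23}+2t^{22}-4t^{21}+2t^{20}-2t^{19}+6t^{18}-3t^{17}+2t^{16}-4t^{15}+3t^{14}-2t^{13}+t^{12}+2t^{10}-t^{9})\alpha+t^{16}-2t^{13}+t^{12}-2t^{11}+t^{10}-t^{9}+3t^{8}-t^{7}+t^{6}-2t^{5}+t^{4}-2t^{3}+1\big]$ $7/75$ ( * ): $t^{-2}(t+1)\big[(t^{40}+t^{39}-t^{38}-t^{36}-2t^{34}+2t^{33}-t^{32}+2t^{31}-3t^{30}+t^{29}-t^{28}+2t^{27}-t^{26}+2t^{25}-t^{22})\alpha^2+(2t^{30}+2t^{29}-2t^{28}-2t^{26}-4t^{24}+4t^{23}-2t^{22}+4t^{21}-4t^{20}+3t^{19}-2t^{18}+4t^{17}-3t^{16}+2t^{15}-t^{14}-2t^{12}+t^{11})\alpha+t^{20}+t^{19}-t^{18}-t^{16}-2t^{14}+2t^{13}-t^{12}+2t^{11}-t^{10}+2t^{9}-t^{8}+2t^{7}-2t^{6}-t^{4}-t^{2}+t+1\big]$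 $\ell=7$: $3/7$: $(t+1)\big[(t^{42}-2t^{40}+3t^{39}-4t^{38}+5t^{37}-6t^{36}+6t^{35}-8t^{34}+11t^{33}-13t^{32}+15t^{31}-17t^{30}+19t^{29}-23t^{28}+23t^{27}-21t^{26}+21t^{25}-21t^{24}+21t^{23}-21t^{22}+23t^{21}-21t^{20}+17t^{19}-15t^{18}+13t^{17}-11t^{16}+9t^{15}-6t^{14}+5t^{13}-5t^{12}+4t^{11}-3t^{10}+2t^{9}-t^{8}-t^{7}+t^{6})\alpha^3+(3t^{28}-4t^{26}+6t^{25}-7t^{24}+7t^{23}-7t^{22}+4t^{21}-7t^{20}+11t^{19}-13t^{18}+14t^{17}-14t^{16}+14t^{15}-17t^{14}+14t^{13}-10t^{12}+8t^{11}-7t^{10}+7t^{9}-7t^{8}+10t^{7}-7t^{6}+3t^{5}-t^{4})\alpha^2+(3t^{14}-2t^{12}+3t^{11}-3t^{10}+2t^{9}-3t^{7}+2t^{5}-3t^{4}+3t^{3}-2t^{2})\alpha+1\big]$ $3/35$: $-t^{-3}(t+1)\big[(t^{72}-t^{71}-t^{70}+2t^{69}-3t^{68}+4t^{67}-5t^{66}+5t^{65}-6t^{64}+9t^{63}-11t^{62}+13t^{61}-15t^{60}+17t^{59}-21t^{58}+23t^{57}-21t^{56}+21t^{55}-21t^{54}+21t^{53}-21t^{52}+23t^{51}-23t^{50}+19t^{49}-17t^{48}+15t^{47}-13t^{46}+11t^{45}-8t^{44}+6t^{43}-6t^{42}+5t^{41}-4t^{40}+3t^{39}-2t^{38}+t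^{36})\alpha^3+(3t^{58}-3t^{57}-3t^{56}+6t^{55}-9t^{54}+12t^{53}-15t^{52}+15t^{51}-18t^{50}+27t^{49}-33t^{48}+39t^{47}-44t^{46}+48t^{45}-56t^{44}+59t^{43}-56t^{42}+56t^{41}-56t^{40}+55t^{39}-53t^{38}+55t^{37}-52t^{36}+43t^{35}-37t^{34}+31t^{33}-26t^{32}+22t^{31}-17t^{30}+14t^{29}-11t^{28}+8t^{27}-5t^{26}+3t^{25}-2t^{24})\alpha^2+(3t^{44}-3t^{43}-3t^{42}+6t^{41}-9t^{40}+12t^{39}-15t^{38}+15t^{37}-18t^{36}+27t^{35}-33t^{34}+39t^{33}-43t^{32}+45t^{31}-49t^{30}+49t^{29}-49t^{28}+49t^{27}-49t^{26}+47t^{25}-43t^{24}+41t^{23}-35t^{22}+29t^{21}-25t^{20}+20t^{19}-16t^{18}+13t^{17}-10t^{16}+7t^{15}-4t^{14}+3t^{13}-t^{12})\alpha+t^{30}-t^{29}-t^{28}+2t^{27}-3t^{26}+4t^{25}-5t^{24}+5t^{23}-6t^{22}+9t^{21}-11t^{20}+13t^{19}-14t^{18}+14t^{17}-14t^{16}+13t^{15}-14t^{14}+14t^{13}-14t^{12}+13t^{11}-11t^{10}+9t^{9}-6t^{8}+5t^{7}-5t^{6}+4t^{5}-3t^{4}+2t^{3}-t^{2}-t+1\big]$ $5/7$: $(t+1)\big[(t^{42}+2t^{41}-4t^{40}+2t^{39}-3t^{38}+5t^{37}-6t^{36}+6t^{35}-10t^{34}+13t^{33}-12t^{32}+14t^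{31}-17t^{30}+19t^{29}-23t^{28}+19t^{27}-17t^{26}+23t^{25}-23t^{24}+21t^{23}-21t^{22}+23t^{21}-17t^{20}+13t^{19}-17t^{18}+15t^{17}-11t^{16}+9t^{15}-6t^{14}+7t^{13}-7t^{12}+3t^{11}-2t^{10}+2t^{9}-t^{8}-t^{7}-t^{6}+2t^{5}+t^{4}-t^{3})\alpha^3+(3t^{28}+4t^{27}-7t^{26}+3t^{25}-4t^{24}+6t^{23}-7t^{22}+4t^{21}-11t^{20}+14t^{19}-10t^{18}+11t^{17}-13t^{16}+14t^{15}-17t^{14}+10t^{13}-7t^{12}+11t^{11}-10t^{10}+8t^{9}-7t^{8}+10t^{7}-3t^{6}-4t^{4}+3t^{3}-t^{2})\alpha^2+(3t^{14}+2t^{13}-3t^{12}+3t^{9}-2t^{8}-3t^{7}-2t^{6}+3t^{5}-3t^{2}+2t)\alpha+1\big]$ $5/21$: $-(t+1)\big[(t^{48}-4t^{47}+6t^{46}-7t^{45}+8t^{44}-9t^{43}+10t^{42}-12t^{41}+16t^{40}-19t^{39}+21t^{38}-23t^{37}+25t^{36}-27t^{35}+27t^{34}-23t^{33}+21t^{32}-21t^{31}+21t^{30}-21t^{29}+21t^{28}-19t^{27}+13t^{26}-9t^{25}+7t^{24}-5t^{23}+3t^{22}-t^{21}-t^{19}+t^{18}-t^{16}+2t^{15}-3t^{14}+3t^{13}-t^{12})\alpha^3+(3t^{34}-12t^{33}+18t^{32}-21t^{31}+22t^{30}-22t^{29}+21t^{28}-24t^{27}+33t^{26}-39t^{25}+42t^{24}-43t^{23}+43t^{22}-42t^{21}+39t^{20}-30t^{19}+24t^{18}-21t^{17}+20t^{16}-20t^{15}+21t^{14}-18t^{13}+9t^{12}-3t^{11}+t^{9}-t^{8})\alpha^2+(3t^{20}-12t^{19}+18t^{18}-21t^{17}+20t^{16}-17t^{15}+12t^{14}-12t^{13}+17t^{12}-20t^{11}+21t^{10}-20t^{9}+17t^{8}-12t^{7}+9t^{6}-5t^{5}+2t^{4})\alpha+t^{6}-4t^{5}+6t^{4}-7t^{3}+6t^{2}-4t+1\big]$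 $5/49$: $-t^{-3}(t+1)\big[(t^{66}-3t^{65}+3t^{64}-2t^{63}+t^{62}-t^{60}+t^{59}+t^{57}-3t^{56}+5t^{55}-7t^{54}+9t^{53}-13t^{52}+19t^{51}-21t^{50}+21t^{49}-21t^{48}+21t^{47}-21t^{46}+23t^{45}-27t^{44}+27t^{43}-25t^{42}+23t^{41}-21t^{40}+19t^{39}-16t^{38}+12t^{37}-10t^{36}+9t^{35}-8t^{34}+7t^{33}-6t^{32}+4t^{31}-t^{30})\alpha^3+(3t^{52}-9t^{51}+9t^{50}-6t^{49}+3t^{48}-3t^{46}+3t^{45}+3t^{43}-10t^{42}+16t^{41}-21t^{40}+24t^{39}-30t^{38}+39t^{37}-42t^{36}+43t^{35}-43t^{34}+42t^{33}-39t^{32}+39t^{31}-42t^{30}+39t^{29}-32t^{28}+26t^{27}-21t^{26}+18t^{25}-15t^{24}+12t^{23}-9t^{22}+5t^{21}-2t^{20})\alpha^2+(3t^{38}-9t^{37}+9t^{36}-6t^{35}+3t^{34}-3t^{32}+3t^{31}+3t^{29}-11t^{28}+17t^{27}-21t^{26}+21t^{25}-21t^{24}+21t^{23}-21t^{22}+23t^{21}-23t^{20}+21t^{19}-17t^{18}+14t^{17}-12t^{16}+9t^{15}-6t^{14}+3t^{13}-t^{11}+t^{10})\alpha+t^{24}-3t^{23}+3t^{22}-2t^{21}+t^{20}-t^{18}+t^{17}+t^{15}-4t^{14}+6t^{13}-7t^{12}+6t^{11}-4t^{10}+t^{9}+t^{7}-t^{6}+t^{4}-2t^{3}+3t^{2}-3t+1\big]$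 $5/63$: $t^{-6}(t+1)\big[(t^{78}-t^{77}-2t^{76}+t^{75}+t^{74}+t^{73}-2t^{72}+2t^{71}-3t^{70}+7t^{69}-7t^{68}+6t^{67}-9t^{66}+11t^{65}-15t^{64}+17t^{63}-13t^{62}+17t^{61}-23t^{60}+21t^{59}-21t^{58}+23t^{57}-23t^{56}+17t^{55}-19t^{54}+23t^{53}-19t^{52}+17t^{51}-14t^{50}+12t^{49}-13t^{48}+10t^{47}-6t^{46}+6t^{45}-5t^{44}+3t^{43}-2t^{42}+4t^{41}-2t^{40}-t^{39})\alpha^3+(3t^{64}-3t^{63}-6t^{62}+3t^{61}+3t^{60}+3t^{59}-6t^{58}+6t^{57}-9t^{56}+21t^{55}-21t^{54}+18t^{53}-27t^{52}+32t^{51}-42t^{50}+47t^{49}-39t^{48}+48t^{47}-59t^{46}+56t^{45}-55t^{44}+59t^{43}-58t^{42}+44t^{41}-47t^{40}+52t^{39}-43t^{38}+38t^{37}-31t^{36}+26t^{35}-25t^{34}+19t^{33}-14t^{32}+11t^{31}-9t^{30}+5t^{29}-3t^{28}+5t^{27}-2t^{26})\alpha^2+(3t^{50}-3t^{49}-6t^{48}+3t^{47}+3t^{46}+3t^{45}-6t^{44}+6t^{43}-9t^{42}+21t^{41}-21t^{40}+18t^{39}-27t^{38}+31t^{37}-39t^{36}+43t^{35}-39t^{34}+45t^{33}-49t^{32}+49t^{31}-47t^{30}+49t^{29}-47t^{28}+37t^{27}-37t^{26}+35t^{25}-31t^{24}+28t^{23}-20t^{22}+16t^{21}-14t^{20}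+10t^{19}-7t^{18}+6t^{17}-6t^{16}+t^{15}+t^{13})\alpha+t^{36}-t^{35}-2t^{34}+t^{33}+t^{32}+t^{31}-2t^{30}+2t^{29}-3t^{28}+7t^{27}-7t^{26}+6t^{25}-9t^{24}+10t^{23}-12t^{22}+13t^{21}-13t^{20}+14t^{19}-13t^{18}+14t^{17}-13t^{16}+13t^{15}-12t^{14}+10t^{13}-9t^{12}+6t^{11}-7t^{10}+7t^{9}-3t^{8}+2t^{7}-2t^{6}+t^{5}+t^{4}+t^{3}-2t^{2}-t+1\big]$
   Formalization: In the table for ℓ=5 and ℓ=7 the factor (t+1) of f(t) is replaced by (t+1)^{(ℓ-1)/2}; with the literal factor the claim fails, e.g. for ℓ=5, p/q=3/5, k=j=0, where (Δ/(t+1))^2 ≡ t^{-2}(t+1)^2 mod 5 but f=t^{-2}(t+1). *)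

(* Defs.v *)
From HB Require Import structures.
From mathcomp Require Import all_boot all_order all_algebra.
From mathcomp Require Import boolp reals complex.

Set Implicit Arguments.
Unset Strict Implicit.
Unset Printing Implicit Defensive.

Import GRing.Theory.

Local Open Scope ring_scope.
Local Open Scope quotient_scope.

(* The letter (g, true) is the generator g and (g, false) is its inverse. *)
Definition word := seq (bool * bool).

Definition winv (u : word) : word := rev [seq (x.1, ~~ x.2) | x <- u].

(* Equality of words in the group with generators true and false and with
   relations l = r for (l, r) in rels. *)
Inductive weq (rels : seq (word * word)) : word -> word -> Prop :=
| weq_refl u : weq rels u u
| weq_sym u v : weq rels u v -> weq rels v u
| weq_trans v u w : weq rels u v -> weq rels v w -> weq rels u w
| weq_cancel u v g s : weq rels (u ++ [:: (g, s); (g, ~~ s)] ++ v) (u ++ v)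
| weq_rel u v l r : (l, r) \in rels -> weq rels (u ++ l ++ v) (u ++ r ++ v).

Definition weqb rels : rel word := fun u v => `[< weq rels u v >].

Section PresentedGroup.
Variable rels : seq (word * word).

Lemma weqb_refl : reflexive (weqb rels).
Proof. by move=> u; apply/asboolP; exact: weq_refl. Qed.

Lemma weqb_sym : symmetric (weqb rels).
Proof.
by move=> u v; apply/asboolP/asboolP => uv; exact: weq_sym.
Qed.

Lemma weqb_trans : transitive (weqb rels).
Proof.
move=> v u w /asboolP uv /asboolP vw; apply/asboolP.
exact: weq_trans uv vw.
Qed.

Canonical weqb_equiv := EquivRel (weqb rels) weqb_refl weqb_sym weqb_trans.

Definition presented := {eq_quot weqb rels}.

HB.instance Definition _ := Choice.on presented.
HB.instance Definition _ := EqQuotient.on presented.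

Lemma weq_cat u u' v v' :
  weq rels u u' -> weq rels v v' -> weq rels (u ++ v) (u' ++ v').
Proof.
move=> uu' vv'; apply: (@weq_trans _ (u' ++ v)).
- elim: uu' v {vv'} => {u u'} [u|u u' _ IH|u u1 w _ IH1 _ IH2|u u' g s|u u' l r lr] v.
  + exact: weq_refl.
  + exact/weq_sym/IH.
  + exact: weq_trans (IH1 v) (IH2 v).
  + by rewrite -!catA; exact: weq_cancel.
  + by rewrite -!catA; exact: weq_rel.
- elim: vv' => {v v'} [v|v v' _ IH|v v1 w _ IH1 _ IH2|v v' g s|v v' l r lr].
  + exact: weq_refl.
  + exact/weq_sym/IH.
  + exact: weq_trans IH1 IH2.
  + by rewrite !(catA u'); exact: weq_cancel.
  + by rewrite !(catA u'); exact: weq_rel.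
Qed.

Lemma weq_mulV u : weq rels (u ++ winv u) [::].
Proof.
elim: u => [|[g s] u IH]; first exact: weq_refl.
rewrite /winv /= rev_cons -cats1 -/(winv u).
have := weq_cat (weq_refl rels [:: (g, s)])
  (weq_cat IH (weq_refl rels [:: (g, ~~ s)])).
rewrite -catA /= => /weq_trans; apply.
exact: (weq_cancel rels [::] [::] g s).
Qed.

Lemma winvK : involutive winv.
Proof.
move=> u; rewrite /winv map_rev revK -map_comp -[RHS]map_id.
by apply: eq_map => -[g s] /=; rewrite negbK.
Qed.

Lemma weq_Vmul u : weq rels (winv u ++ u) [::].
Proof. by rewrite -{2}[u]winvK; exact: weq_mulV. Qed.

Definition pword (u : word) : presented := \pi u.

Lemma pwordP u v : pword u = pword v <-> weq rels u v.
Proof.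
split=> [/eqP|uv]; last by apply/eqP; rewrite /pword eqmodE; apply/asboolP.
by rewrite /pword eqmodE => /asboolP.
Qed.

Lemma weq_repr u : weq rels (repr (pword u)) u.
Proof. by apply/pwordP; rewrite /pword reprK. Qed.

Definition pmul (g h : presented) : presented := pword (repr g ++ repr h).
Definition pinv (g : presented) : presented := pword (winv (repr g)).

Lemma pmulA : associative pmul.
Proof.
move=> g h k; apply/pwordP.
apply: (@weq_trans _ (repr g ++ repr h ++ repr k)).
  exact: weq_cat (weq_refl _ _) (weq_repr _).
rewrite catA; apply: weq_sym.
exact: weq_cat (weq_repr _) (weq_refl _ _).
Qed.

Lemma pmul1 : left_id (pword [::]) pmul.
Proof.
move=> g; rewrite -[RHS]reprK; apply/pwordP.
exact: (weq_cat (weq_repr [::]) (weq_refl _ (repr g))).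
Qed.

Lemma pmulr1 : right_id (pword [::]) pmul.
Proof.
move=> g; rewrite -[RHS]reprK; apply/pwordP; rewrite -[X in weq _ _ X]cats0.
exact: (weq_cat (weq_refl _ (repr g)) (weq_repr [::])).
Qed.

Lemma pmulV : left_inverse (pword [::]) pinv pmul.
Proof.
move=> g; apply/pwordP; apply: weq_trans (weq_Vmul (repr g)).
exact: weq_cat (weq_repr _) (weq_refl _ _).
Qed.

Lemma pmulrV : right_inverse (pword [::]) pinv pmul.
Proof.
move=> g; apply/pwordP; apply: weq_trans (weq_mulV (repr g)).
exact: weq_cat (weq_refl _ _) (weq_repr _).
Qed.

HB.instance Definition _ :=
  isGroup.Build presented pmulA pmul1 pmulr1 pmulV pmulrV.

End PresentedGroup.

Definition pgen rels (g : bool) : presented rels := pword rels [:: (g, true)].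

Definition eps (p q i : nat) : int := (-1) ^+ ((i * p) %/ q)%N.

Definition ga := true.
Definition gb := false.

(* b^(e_1) a^(e_2) b^(e_3) ... a^(e_(q-1)) *)
Definition knot_word (p q : nat) : word :=
  [seq (if odd i then gb else ga, eps p q i == 1) | i <- iota 1 q.-1].

(* < a, b | a w = w b > *)
Definition knot_group (p q : nat) := presented
  [:: ((ga, true) :: knot_word p q, rcons (knot_word p q) (gb, true))].

Definition gx := true.
Definition gy := false.

(* < x, y | x^2 = 1, y^l = 1, y x = x y^-1 > *)
Definition dihedral (l : nat) := presented
  [:: ([:: (gx, true); (gx, true)], [::]);
      (nseq l (gy, true), [::]);
      ([:: (gy, true); (gx, true)], [:: (gx, true); (gy, false)])].

Definition flip_mx (F : fieldType) n : 'M[F]_n :=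
  \matrix_(i, j) (i + j == n.-1)%N%:R.

Definition shift_mx (F : fieldType) n : 'M[F]_n :=
  \matrix_(i, j) ((i == j.+1 :> nat) || (i == 0%N :> nat) && (j == n.-1 :> nat))%:R.

(* Such a map automatically takes values in invertible matrices. *)
Definition is_representation (F : fieldType) (G : groupType) n
    (f : G -> 'M[F]_n) : Prop :=
  f 1%g = 1%:M /\ {morph f : x y / (x * y)%g >-> x *m y}.

(* The Fox derivative of u with respect to g, as a formal integral combination
   of words. *)
Fixpoint fox (g : bool) (u : word) : seq (int * word) :=
  if u is (h, s) :: v then
    (if h == g then [:: if s then (1, [::]) else (-1, [:: (h, false)])]
     else [::]) ++ [seq (z.1, (h, s) :: z.2) | z <- fox g v]
  else [::].

Section Evaluation.
Variables (K : fieldType) (n : nat) (A B : 'M[K]_n).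

Definition eval_letter (x : bool * bool) : 'M[K]_n :=
  let M := if x.1 == ga then A else B in if x.2 then M else invmx M.

Definition eval_word (u : word) : 'M[K]_n :=
  foldr (fun x M => eval_letter x *m M) 1%:M u.

Definition eval_gring (z : seq (int * word)) : 'M[K]_n :=
  \sum_(y <- z) eval_word y.2 *~ y.1.

End Evaluation.

(* A Laurent polynomial with integer coefficients is read in ratfun F as its
   value at tvar F; for F = 'F_l this is reduction modulo l. *)
Notation ratfun F := {fraction {poly F}}.

Definition tvar (F : fieldType) : ratfun F := tofrac 'X.

Definition const_fun (F : fieldType) (c : F) : ratfun F := tofrac c%:P.

(* Defined up to a factor +-t^(m n). *)
Definition twisted_alexander (F : fieldType) n p q
    (phi : knot_group p q -> 'M[F]_n) : ratfun F :=
  let A := tvar F *: map_mx (@const_fun F) (phi (pgen _ ga)) in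
  let B := tvar F *: map_mx (@const_fun F) (phi (pgen _ gb)) in
  let Ahat := 1%:M + (A - 1%:M) *m eval_gring A B (fox ga (knot_word p q)) in
  \det Ahat / \det (B - 1%:M).

(* The value at t of the Laurent polynomial
   1 - t^(e_1) + t^(e_1 + e_2) - ... + t^(e_1 + ... + e_(q-1)). *)
Definition alexander (K : fieldType) (p q : nat) (t : K) : K :=
  \sum_(0 <= i < q) (-1) ^+ i * t ^ (\sum_(1 <= m < i.+1) eps p q m).

(* Equality up to a factor +-t^(m l). *)
Definition doteq (F : fieldType) (l : nat) (f g : ratfun F) : Prop :=
  exists (s : bool) (m : int), f = (-1) ^+ s * tvar F ^ (m * l%:Z) * g.

Definition alpha (K : fieldType) (l k : nat) (t : K) : K :=
  (t ^+ (2 * l * k)%N - 1) / (t ^+ (2 * l)%N - 1).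

(* (s, m, [:: c_d; ..; c_0]) stands for the Laurent polynomial
   (-1)^s t^m (t + 1)^((l - 1)/2) (c_d(t) alpha^d + ... + c_0(t)), where each
   c_i is the list of its monomials (coefficient, exponent). *)
Definition coef_data := (bool * int * seq (seq (int * nat)))%type.

Definition poly_value (K : fieldType) (c : seq (int * nat)) (t : K) : K :=
  \sum_(y <- c) y.1%:~R * t ^+ y.2.

Definition f_value (K : fieldType) (l k : nat) (f : coef_data) (t : K) : K :=
  let: (s, m, cs) := f in
  (-1) ^+ s * t ^ m * (t + 1) ^+ (l.-1)./2 *
  foldl (fun v c => v * alpha l k t + poly_value c t) 0 cs.

Local Close Scope ring_scope.

Local Notation "c *t^ e" := (c%Z, e%N) (at level 40).

(* The entries are (l, p, q, whether j = 0 is required) with the data of f. The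
   exponent (l - 1)/2 of the factor t + 1 is the one required by
   f = (Delta / (t + 1))^((l - 1)/2) mod l: for l = 5, p/q = 3/5 and k = j = 0,
   Delta = 3 - t - t^-1 is congruent to -t^-1 (t + 1)^2 mod 5, so that
   f = t^-2 (t + 1)^2 mod 5. *)
Definition table : seq ((nat * nat * nat * bool) * coef_data) := [::
  ((3, 5, 9, false), (false, (-1)%Z,
    [:: [:: 1 *t^ 6; -1 *t^ 3];
      [:: 1 *t^ 0]]));
  ((3, 5, 21, false), (false, (1)%Z,
    [:: [:: 1 *t^ 6; -1 *t^ 3];
      [:: 1 *t^ 0]]));
  ((3, 5, 27, false), (true, (0)%Z,
    [:: [:: 1 *t^ 10; -1 *t^ 9; -1 *t^ 8; -1 *t^ 7; 1 *t^ 6; 1 *t^ 5];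
      [:: 1 *t^ 4; -1 *t^ 3; -1 *t^ 2; -1 *t^ 1; 1 *t^ 0]]));
  ((3, 5, 33, true), (false, (-2)%Z,
    [:: [:: 1 *t^ 12; 1 *t^ 11; -1 *t^ 10; -1 *t^ 9; -1 *t^ 8; 1 *t^ 7];
      [:: 1 *t^ 6; 1 *t^ 5; -1 *t^ 4; -1 *t^ 3; -1 *t^ 2; 1 *t^ 1; 1 *t^ 0]]));
  ((3, 7, 9, false), (false, (-1)%Z,
    [:: [:: 1 *t^ 6; 1 *t^ 5; -1 *t^ 4; -1 *t^ 3; -1 *t^ 2; 1 *t^ 1];
      [:: 1 *t^ 0]]));
  ((3, 7, 15, false), (false, (0)%Z,
    [:: [:: 1 *t^ 6; -1 *t^ 3];
      [:: 1 *t^ 0]]));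
  ((3, 7, 27, true), (false, (0)%Z,
    [:: [:: 1 *t^ 6; -1 *t^ 3];
      [:: 1 *t^ 0]]));
  ((3, 7, 33, false), (true, (-1)%Z,
    [:: [:: 1 *t^ 10; -1 *t^ 9; -1 *t^ 8; -1 *t^ 7; 1 *t^ 6; 1 *t^ 5];
      [:: 1 *t^ 4; -1 *t^ 3; -1 *t^ 2; -1 *t^ 1; 1 *t^ 0]]));
  ((3, 7, 39, false), (true, (-3)%Z,
    [:: [:: 1 *t^ 12; 1 *t^ 11; -1 *t^ 10; -3 *t^ 9; -1 *t^ 8; 1 *t^ 7;
       2 *t^ 6];
      [:: 1 *t^ 6; 1 *t^ 5; -1 *t^ 4; -3 *t^ 3; -1 *t^ 2; 1 *t^ 1; 1 *t^ 0]]));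
  ((3, 7, 45, true), (false, (0)%Z,
    [:: [:: 2 *t^ 12; 1 *t^ 11; -1 *t^ 10; -3 *t^ 9; -1 *t^ 8; 1 *t^ 7;
       1 *t^ 6];
      [:: 2 *t^ 6; 1 *t^ 5; -1 *t^ 4; -3 *t^ 3; -1 *t^ 2; 1 *t^ 1; 2 *t^ 0]]));
  ((5, 3, 5, false), (false, (-2)%Z,
    [:: [:: 1 *t^ 20; -1 *t^ 18; 1 *t^ 17; -1 *t^ 16; -1 *t^ 14; 2 *t^ 13;
       -2 *t^ 12; 2 *t^ 11; -3 *t^ 10; 2 *t^ 9; -1 *t^ 8; 1 *t^ 7;
       -1 *t^ 6; 2 *t^ 5; -1 *t^ 4];
      [:: 2 *t^ 10; -1 *t^ 8; 1 *t^ 7; -2 *t^ 5; 1 *t^ 3; -1 *t^ 2];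
      [:: 1 *t^ 0]]));
  ((5, 3, 25, false), (true, (0)%Z,
    [:: [:: 1 *t^ 32; -2 *t^ 31; 1 *t^ 30; -1 *t^ 29; 1 *t^ 28; -2 *t^ 27;
       3 *t^ 26; -2 *t^ 25; 2 *t^ 24; -2 *t^ 23; 1 *t^ 22; 1 *t^ 20;
       -1 *t^ 19; 1 *t^ 18; -1 *t^ 16];
      [:: 2 *t^ 22; -4 *t^ 21; 2 *t^ 20; -2 *t^ 19; 2 *t^ 18; -4 *t^ 17;
       6 *t^ 16; -4 *t^ 15; 3 *t^ 14; -3 *t^ 13; 2 *t^ 12; -2 *t^ 11;
       2 *t^ 10; -1 *t^ 9; 1 *t^ 8];
      [:: 1 *t^ 12; -2 *t^ 11; 1 *t^ 10; -1 *t^ 9; 1 *t^ 8; -2 *t^ 7;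
       3 *t^ 6; -2 *t^ 5; 1 *t^ 4; -1 *t^ 3; 1 *t^ 2; -2 *t^ 1; 1 *t^ 0]]));
  ((5, 7, 15, false), (false, (0)%Z,
    [:: [:: 1 *t^ 20; -1 *t^ 18; 1 *t^ 17; -1 *t^ 16; -1 *t^ 14; 2 *t^ 13;
       -2 *t^ 12; 2 *t^ 11; -3 *t^ 10; 2 *t^ 9; -1 *t^ 8; 1 *t^ 7;
       -1 *t^ 6; 2 *t^ 5; -1 *t^ 4];
      [:: 2 *t^ 10; -1 *t^ 8; 1 *t^ 7; -2 *t^ 5; 1 *t^ 3; -1 *t^ 2];
      [:: 1 *t^ 0]]));
  ((5, 7, 25, false), (false, (-6)%Z,
    [:: [:: 1 *t^ 28; -2 *t^ 26; 2 *t^ 24; -1 *t^ 23; -1 *t^ 22; 3 *t^ 21;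
       -1 *t^ 20; -1 *t^ 19; -2 *t^ 18; 2 *t^ 17; 2 *t^ 15; -4 *t^ 14;
       3 *t^ 13; -1 *t^ 12; -1 *t^ 11; -1 *t^ 10; 3 *t^ 9; -1 *t^ 8];
      [:: 2 *t^ 18; -4 *t^ 16; 5 *t^ 14; -1 *t^ 13; -3 *t^ 12; 3 *t^ 11;
       1 *t^ 10; -4 *t^ 9; -1 *t^ 8; 3 *t^ 7; 1 *t^ 6; -1 *t^ 5; -1 *t^ 4];
      [:: 1 *t^ 8; -2 *t^ 6; 3 *t^ 4; -2 *t^ 2; 1 *t^ 0]]));
  ((5, 7, 45, false), (true, (0)%Z,
    [:: [:: 1 *t^ 32; -3 *t^ 31; 1 *t^ 30; 1 *t^ 29; 1 *t^ 28; -3 *t^ 27;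
       4 *t^ 26; -2 *t^ 25; -2 *t^ 23; 2 *t^ 22; 1 *t^ 21; 1 *t^ 20;
       -3 *t^ 19; 1 *t^ 18; 1 *t^ 17; -2 *t^ 16; 2 *t^ 14; -1 *t^ 12];
      [:: 2 *t^ 22; -6 *t^ 21; 2 *t^ 20; 2 *t^ 19; 2 *t^ 18; -6 *t^ 17;
       7 *t^ 16; -5 *t^ 15; 1 *t^ 14; -1 *t^ 13; 3 *t^ 12; -2 *t^ 11;
       3 *t^ 10; -3 *t^ 9; -1 *t^ 8; 1 *t^ 7; 1 *t^ 6];
      [:: 1 *t^ 12; -3 *t^ 11; 1 *t^ 10; 1 *t^ 9; 1 *t^ 8; -3 *t^ 7; 3 *t^ 6;
       -3 *t^ 5; 1 *t^ 4; 1 *t^ 3; 1 *t^ 2; -3 *t^ 1; 1 *t^ 0]]));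
  ((5, 7, 55, false), (true, (-2)%Z,
    [:: [:: 1 *t^ 32; -2 *t^ 31; 1 *t^ 30; -1 *t^ 29; 1 *t^ 28; -2 *t^ 27;
       3 *t^ 26; -2 *t^ 25; 2 *t^ 24; -2 *t^ 23; 1 *t^ 22; 1 *t^ 20;
       -1 *t^ 19; 1 *t^ 18; -1 *t^ 16];
      [:: 2 *t^ 22; -4 *t^ 21; 2 *t^ 20; -2 *t^ 19; 2 *t^ 18; -4 *t^ 17;
       6 *t^ 16; -4 *t^ 15; 3 *t^ 14; -3 *t^ 13; 2 *t^ 12; -2 *t^ 11;
       2 *t^ 10; -1 *t^ 9; 1 *t^ 8];
      [:: 1 *t^ 12; -2 *t^ 11; 1 *t^ 10; -1 *t^ 9; 1 *t^ 8; -2 *t^ 7;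
       3 *t^ 6; -2 *t^ 5; 1 *t^ 4; -1 *t^ 3; 1 *t^ 2; -2 *t^ 1; 1 *t^ 0]]));
  ((5, 7, 65, false), (true, (-2)%Z,
    [:: [:: 1 *t^ 36; -2 *t^ 33; 1 *t^ 32; -2 *t^ 31; 1 *t^ 30; -1 *t^ 29;
       3 *t^ 28; -2 *t^ 27; 1 *t^ 26; -2 *t^ 25; 2 *t^ 24; 1 *t^ 22;
       1 *t^ 20; -1 *t^ 19; -1 *t^ 18];
      [:: 2 *t^ 26; -4 *t^ 23; 2 *t^ 22; -4 *t^ 21; 2 *t^ 20; -2 *t^ 19;
       6 *t^ 18; -3 *t^ 17; 2 *t^ 16; -4 *t^ 15; 3 *t^ 14; -2 *t^ 13;
       1 *t^ 12; 2 *t^ 10; -1 *t^ 9];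
      [:: 1 *t^ 16; -2 *t^ 13; 1 *t^ 12; -2 *t^ 11; 1 *t^ 10; -1 *t^ 9;
       3 *t^ 8; -1 *t^ 7; 1 *t^ 6; -2 *t^ 5; 1 *t^ 4; -2 *t^ 3; 1 *t^ 0]]));
  ((5, 7, 75, true), (false, (-2)%Z,
    [:: [:: 1 *t^ 40; 1 *t^ 39; -1 *t^ 38; -1 *t^ 36; -2 *t^ 34; 2 *t^ 33;
       -1 *t^ 32; 2 *t^ 31; -3 *t^ 30; 1 *t^ 29; -1 *t^ 28; 2 *t^ 27;
       -1 *t^ 26; 2 *t^ 25; -1 *t^ 22];
      [:: 2 *t^ 30; 2 *t^ 29; -2 *t^ 28; -2 *t^ 26; -4 *t^ 24; 4 *t^ 23;
       -2 *t^ 22; 4 *t^ 21; -4 *t^ 20; 3 *t^ 19; -2 *t^ 18; 4 *t^ 17;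
       -3 *t^ 16; 2 *t^ 15; -1 *t^ 14; -2 *t^ 12; 1 *t^ 11];
      [:: 1 *t^ 20; 1 *t^ 19; -1 *t^ 18; -1 *t^ 16; -2 *t^ 14; 2 *t^ 13;
       -1 *t^ 12; 2 *t^ 11; -1 *t^ 10; 2 *t^ 9; -1 *t^ 8; 2 *t^ 7;
       -2 *t^ 6; -1 *t^ 4; -1 *t^ 2; 1 *t^ 1; 1 *t^ 0]]));
  ((7, 3, 7, false), (false, (0)%Z,
    [:: [:: 1 *t^ 42; -2 *t^ 40; 3 *t^ 39; -4 *t^ 38; 5 *t^ 37; -6 *t^ 36;
       6 *t^ 35; -8 *t^ 34; 11 *t^ 33; -13 *t^ 32; 15 *t^ 31; -17 *t^ 30;
       19 *t^ 29; -23 *t^ 28; 23 *t^ 27; -21 *t^ 26; 21 *t^ 25;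
       -21 *t^ 24; 21 *t^ 23; -21 *t^ 22; 23 *t^ 21; -21 *t^ 20;
       17 *t^ 19; -15 *t^ 18; 13 *t^ 17; -11 *t^ 16; 9 *t^ 15; -6 *t^ 14;
       5 *t^ 13; -5 *t^ 12; 4 *t^ 11; -3 *t^ 10; 2 *t^ 9; -1 *t^ 8;
       -1 *t^ 7; 1 *t^ 6];
      [:: 3 *t^ 28; -4 *t^ 26; 6 *t^ 25; -7 *t^ 24; 7 *t^ 23; -7 *t^ 22;
       4 *t^ 21; -7 *t^ 20; 11 *t^ 19; -13 *t^ 18; 14 *t^ 17; -14 *t^ 16;
       14 *t^ 15; -17 *t^ 14; 14 *t^ 13; -10 *t^ 12; 8 *t^ 11; -7 *t^ 10;
       7 *t^ 9; -7 *t^ 8; 10 *t^ 7; -7 *t^ 6; 3 *t^ 5; -1 *t^ 4];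
      [:: 3 *t^ 14; -2 *t^ 12; 3 *t^ 11; -3 *t^ 10; 2 *t^ 9; -3 *t^ 7;
       2 *t^ 5; -3 *t^ 4; 3 *t^ 3; -2 *t^ 2];
      [:: 1 *t^ 0]]));
  ((7, 3, 35, false), (true, (-3)%Z,
    [:: [:: 1 *t^ 72; -1 *t^ 71; -1 *t^ 70; 2 *t^ 69; -3 *t^ 68; 4 *t^ 67;
       -5 *t^ 66; 5 *t^ 65; -6 *t^ 64; 9 *t^ 63; -11 *t^ 62; 13 *t^ 61;
       -15 *t^ 60; 17 *t^ 59; -21 *t^ 58; 23 *t^ 57; -21 *t^ 56;
       21 *t^ 55; -21 *t^ 54; 21 *t^ 53; -21 *t^ 52; 23 *t^ 51;
       -23 *t^ 50; 19 *t^ 49; -17 *t^ 48; 15 *t^ 47; -13 *t^ 46;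
       11 *t^ 45; -8 *t^ 44; 6 *t^ 43; -6 *t^ 42; 5 *t^ 41; -4 *t^ 40;
       3 *t^ 39; -2 *t^ 38; 1 *t^ 36];
      [:: 3 *t^ 58; -3 *t^ 57; -3 *t^ 56; 6 *t^ 55; -9 *t^ 54; 12 *t^ 53;
       -15 *t^ 52; 15 *t^ 51; -18 *t^ 50; 27 *t^ 49; -33 *t^ 48;
       39 *t^ 47; -44 *t^ 46; 48 *t^ 45; -56 *t^ 44; 59 *t^ 43;
       -56 *t^ 42; 56 *t^ 41; -56 *t^ 40; 55 *t^ 39; -53 *t^ 38;
       55 *t^ 37; -52 *t^ 36; 43 *t^ 35; -37 *t^ 34; 31 *t^ 33;
       -26 *t^ 32; 22 *t^ 31; -17 *t^ 30; 14 *t^ 29; -11 *t^ 28; 8 *t^ 27;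
       -5 *t^ 26; 3 *t^ 25; -2 *t^ 24];
      [:: 3 *t^ 44; -3 *t^ 43; -3 *t^ 42; 6 *t^ 41; -9 *t^ 40; 12 *t^ 39;
       -15 *t^ 38; 15 *t^ 37; -18 *t^ 36; 27 *t^ 35; -33 *t^ 34;
       39 *t^ 33; -43 *t^ 32; 45 *t^ 31; -49 *t^ 30; 49 *t^ 29;
       -49 *t^ 28; 49 *t^ 27; -49 *t^ 26; 47 *t^ 25; -43 *t^ 24;
       41 *t^ 23; -35 *t^ 22; 29 *t^ 21; -25 *t^ 20; 20 *t^ 19;
       -16 *t^ 18; 13 *t^ 17; -10 *t^ 16; 7 *t^ 15; -4 *t^ 14; 3 *t^ 13;
       -1 *t^ 12];
      [:: 1 *t^ 30; -1 *t^ 29; -1 *t^ 28; 2 *t^ 27; -3 *t^ 26; 4 *t^ 25;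
       -5 *t^ 24; 5 *t^ 23; -6 *t^ 22; 9 *t^ 21; -11 *t^ 20; 13 *t^ 19;
       -14 *t^ 18; 14 *t^ 17; -14 *t^ 16; 13 *t^ 15; -14 *t^ 14;
       14 *t^ 13; -14 *t^ 12; 13 *t^ 11; -11 *t^ 10; 9 *t^ 9; -6 *t^ 8;
       5 *t^ 7; -5 *t^ 6; 4 *t^ 5; -3 *t^ 4; 2 *t^ 3; -1 *t^ 2; -1 *t^ 1;
       1 *t^ 0]]));
  ((7, 5, 7, false), (false, (0)%Z,
    [:: [:: 1 *t^ 42; 2 *t^ 41; -4 *t^ 40; 2 *t^ 39; -3 *t^ 38; 5 *t^ 37;
       -6 *t^ 36; 6 *t^ 35; -10 *t^ 34; 13 *t^ 33; -12 *t^ 32; 14 *t^ 31;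
       -17 *t^ 30; 19 *t^ 29; -23 *t^ 28; 19 *t^ 27; -17 *t^ 26;
       23 *t^ 25; -23 *t^ 24; 21 *t^ 23; -21 *t^ 22; 23 *t^ 21;
       -17 *t^ 20; 13 *t^ 19; -17 *t^ 18; 15 *t^ 17; -11 *t^ 16; 9 *t^ 15;
       -6 *t^ 14; 7 *t^ 13; -7 *t^ 12; 3 *t^ 11; -2 *t^ 10; 2 *t^ 9;
       -1 *t^ 8; -1 *t^ 7; -1 *t^ 6; 2 *t^ 5; 1 *t^ 4; -1 *t^ 3];
      [:: 3 *t^ 28; 4 *t^ 27; -7 *t^ 26; 3 *t^ 25; -4 *t^ 24; 6 *t^ 23;
       -7 *t^ 22; 4 *t^ 21; -11 *t^ 20; 14 *t^ 19; -10 *t^ 18; 11 *t^ 17;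
       -13 *t^ 16; 14 *t^ 15; -17 *t^ 14; 10 *t^ 13; -7 *t^ 12; 11 *t^ 11;
       -10 *t^ 10; 8 *t^ 9; -7 *t^ 8; 10 *t^ 7; -3 *t^ 6; -4 *t^ 4;
       3 *t^ 3; -1 *t^ 2];
      [:: 3 *t^ 14; 2 *t^ 13; -3 *t^ 12; 3 *t^ 9; -2 *t^ 8; -3 *t^ 7;
       -2 *t^ 6; 3 *t^ 5; -3 *t^ 2; 2 *t^ 1];
      [:: 1 *t^ 0]]));
  ((7, 5, 21, false), (true, (0)%Z,
    [:: [:: 1 *t^ 48; -4 *t^ 47; 6 *t^ 46; -7 *t^ 45; 8 *t^ 44; -9 *t^ 43;
       10 *t^ 42; -12 *t^ 41; 16 *t^ 40; -19 *t^ 39; 21 *t^ 38;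
       -23 *t^ 37; 25 *t^ 36; -27 *t^ 35; 27 *t^ 34; -23 *t^ 33;
       21 *t^ 32; -21 *t^ 31; 21 *t^ 30; -21 *t^ 29; 21 *t^ 28;
       -19 *t^ 27; 13 *t^ 26; -9 *t^ 25; 7 *t^ 24; -5 *t^ 23; 3 *t^ 22;
       -1 *t^ 21; -1 *t^ 19; 1 *t^ 18; -1 *t^ 16; 2 *t^ 15; -3 *t^ 14;
       3 *t^ 13; -1 *t^ 12];
      [:: 3 *t^ 34; -12 *t^ 33; 18 *t^ 32; -21 *t^ 31; 22 *t^ 30; -22 *t^ 29;
       21 *t^ 28; -24 *t^ 27; 33 *t^ 26; -39 *t^ 25; 42 *t^ 24;
       -43 *t^ 23; 43 *t^ 22; -42 *t^ 21; 39 *t^ 20; -30 *t^ 19;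
       24 *t^ 18; -21 *t^ 17; 20 *t^ 16; -20 *t^ 15; 21 *t^ 14;
       -18 *t^ 13; 9 *t^ 12; -3 *t^ 11; 1 *t^ 9; -1 *t^ 8];
      [:: 3 *t^ 20; -12 *t^ 19; 18 *t^ 18; -21 *t^ 17; 20 *t^ 16; -17 *t^ 15;
       12 *t^ 14; -12 *t^ 13; 17 *t^ 12; -20 *t^ 11; 21 *t^ 10; -20 *t^ 9;
       17 *t^ 8; -12 *t^ 7; 9 *t^ 6; -5 *t^ 5; 2 *t^ 4];
      [:: 1 *t^ 6; -4 *t^ 5; 6 *t^ 4; -7 *t^ 3; 6 *t^ 2; -4 *t^ 1; 1 *t^ 0]]));
  ((7, 5, 49, false), (true, (-3)%Z,
    [:: [:: 1 *t^ 66; -3 *t^ 65; 3 *t^ 64; -2 *t^ 63; 1 *t^ 62; -1 *t^ 60;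
       1 *t^ 59; 1 *t^ 57; -3 *t^ 56; 5 *t^ 55; -7 *t^ 54; 9 *t^ 53;
       -13 *t^ 52; 19 *t^ 51; -21 *t^ 50; 21 *t^ 49; -21 *t^ 48;
       21 *t^ 47; -21 *t^ 46; 23 *t^ 45; -27 *t^ 44; 27 *t^ 43;
       -25 *t^ 42; 23 *t^ 41; -21 *t^ 40; 19 *t^ 39; -16 *t^ 38;
       12 *t^ 37; -10 *t^ 36; 9 *t^ 35; -8 *t^ 34; 7 *t^ 33; -6 *t^ 32;
       4 *t^ 31; -1 *t^ 30];
      [:: 3 *t^ 52; -9 *t^ 51; 9 *t^ 50; -6 *t^ 49; 3 *t^ 48; -3 *t^ 46;
       3 *t^ 45; 3 *t^ 43; -10 *t^ 42; 16 *t^ 41; -21 *t^ 40; 24 *t^ 39;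
       -30 *t^ 38; 39 *t^ 37; -42 *t^ 36; 43 *t^ 35; -43 *t^ 34;
       42 *t^ 33; -39 *t^ 32; 39 *t^ 31; -42 *t^ 30; 39 *t^ 29;
       -32 *t^ 28; 26 *t^ 27; -21 *t^ 26; 18 *t^ 25; -15 *t^ 24;
       12 *t^ 23; -9 *t^ 22; 5 *t^ 21; -2 *t^ 20];
      [:: 3 *t^ 38; -9 *t^ 37; 9 *t^ 36; -6 *t^ 35; 3 *t^ 34; -3 *t^ 32;
       3 *t^ 31; 3 *t^ 29; -11 *t^ 28; 17 *t^ 27; -21 *t^ 26; 21 *t^ 25;
       -21 *t^ 24; 21 *t^ 23; -21 *t^ 22; 23 *t^ 21; -23 *t^ 20;
       21 *t^ 19; -17 *t^ 18; 14 *t^ 17; -12 *t^ 16; 9 *t^ 15; -6 *t^ 14;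
       3 *t^ 13; -1 *t^ 11; 1 *t^ 10];
      [:: 1 *t^ 24; -3 *t^ 23; 3 *t^ 22; -2 *t^ 21; 1 *t^ 20; -1 *t^ 18;
       1 *t^ 17; 1 *t^ 15; -4 *t^ 14; 6 *t^ 13; -7 *t^ 12; 6 *t^ 11;
       -4 *t^ 10; 1 *t^ 9; 1 *t^ 7; -1 *t^ 6; 1 *t^ 4; -2 *t^ 3; 3 *t^ 2;
       -3 *t^ 1; 1 *t^ 0]]));
  ((7, 5, 63, false), (false, (-6)%Z,
    [:: [:: 1 *t^ 78; -1 *t^ 77; -2 *t^ 76; 1 *t^ 75; 1 *t^ 74; 1 *t^ 73;
       -2 *t^ 72; 2 *t^ 71; -3 *t^ 70; 7 *t^ 69; -7 *t^ 68; 6 *t^ 67;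
       -9 *t^ 66; 11 *t^ 65; -15 *t^ 64; 17 *t^ 63; -13 *t^ 62; 17 *t^ 61;
       -23 *t^ 60; 21 *t^ 59; -21 *t^ 58; 23 *t^ 57; -23 *t^ 56;
       17 *t^ 55; -19 *t^ 54; 23 *t^ 53; -19 *t^ 52; 17 *t^ 51;
       -14 *t^ 50; 12 *t^ 49; -13 *t^ 48; 10 *t^ 47; -6 *t^ 46; 6 *t^ 45;
       -5 *t^ 44; 3 *t^ 43; -2 *t^ 42; 4 *t^ 41; -2 *t^ 40; -1 *t^ 39];
      [:: 3 *t^ 64; -3 *t^ 63; -6 *t^ 62; 3 *t^ 61; 3 *t^ 60; 3 *t^ 59;
       -6 *t^ 58; 6 *t^ 57; -9 *t^ 56; 21 *t^ 55; -21 *t^ 54; 18 *t^ 53;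
       -27 *t^ 52; 32 *t^ 51; -42 *t^ 50; 47 *t^ 49; -39 *t^ 48;
       48 *t^ 47; -59 *t^ 46; 56 *t^ 45; -55 *t^ 44; 59 *t^ 43;
       -58 *t^ 42; 44 *t^ 41; -47 *t^ 40; 52 *t^ 39; -43 *t^ 38;
       38 *t^ 37; -31 *t^ 36; 26 *t^ 35; -25 *t^ 34; 19 *t^ 33;
       -14 *t^ 32; 11 *t^ 31; -9 *t^ 30; 5 *t^ 29; -3 *t^ 28; 5 *t^ 27;
       -2 *t^ 26];
      [:: 3 *t^ 50; -3 *t^ 49; -6 *t^ 48; 3 *t^ 47; 3 *t^ 46; 3 *t^ 45;
       -6 *t^ 44; 6 *t^ 43; -9 *t^ 42; 21 *t^ 41; -21 *t^ 40; 18 *t^ 39;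
       -27 *t^ 38; 31 *t^ 37; -39 *t^ 36; 43 *t^ 35; -39 *t^ 34;
       45 *t^ 33; -49 *t^ 32; 49 *t^ 31; -47 *t^ 30; 49 *t^ 29;
       -47 *t^ 28; 37 *t^ 27; -37 *t^ 26; 35 *t^ 25; -31 *t^ 24;
       28 *t^ 23; -20 *t^ 22; 16 *t^ 21; -14 *t^ 20; 10 *t^ 19; -7 *t^ 18;
       6 *t^ 17; -6 *t^ 16; 1 *t^ 15; 1 *t^ 13];
      [:: 1 *t^ 36; -1 *t^ 35; -2 *t^ 34; 1 *t^ 33; 1 *t^ 32; 1 *t^ 31;
       -2 *t^ 30; 2 *t^ 29; -3 *t^ 28; 7 *t^ 27; -7 *t^ 26; 6 *t^ 25;
       -9 *t^ 24; 10 *t^ 23; -12 *t^ 22; 13 *t^ 21; -13 *t^ 20; 14 *t^ 19;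
       -13 *t^ 18; 14 *t^ 17; -13 *t^ 16; 13 *t^ 15; -12 *t^ 14;
       10 *t^ 13; -9 *t^ 12; 6 *t^ 11; -7 *t^ 10; 7 *t^ 9; -3 *t^ 8;
       2 *t^ 7; -2 *t^ 6; 1 *t^ 5; 1 *t^ 4; 1 *t^ 3; -2 *t^ 2; -1 *t^ 1;
       1 *t^ 0]]))].

(* Main.v *)
(* Since q' = (a + 2lk) p' + r, the signs eps_i of K_{p'/q'} form p' alternating
   blocks, of lengths a + 2lk and a + 2lk + 1; passing from p to p' = p + 2ljr
   inserts 2lj short blocks after each of the r long ones. In a representation
   through the dihedral group, a and b act as t times involutions s and r with
   (s r)^l = 1. Adding 2lk letters to a block therefore multiplies by the scalar
   t^(+-2lk), and the Fox derivative is affine in alpha_k, with coefficients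
   independent of k: it is the interpolation of its values for k = 0 and k = 1.
   Two consecutive short blocks act by a rotation, conjugate to (s r)^(+-a). When
   the first l powers of (s r)^a sum to 0, the inserted blocks contribute nothing;
   this happens on a plane where s r has eigenvalue mu <> 1 and l does not divide
   a, and for the trivial representation in characteristic l.
   The representation of dimension l is the sum of the trivial one, where
   det Ahat is the Alexander polynomial, and of the planes with mu replaced by
   mu^(2^i) for i < (l-1)/2, as 2 and -1 generate (Z/l)^* for l = 3, 5, 7. Both
   claims become polynomial identities in t, alpha and c = mu + 1/mu, which are
   checked by computation for each entry of the table. *)
From HB Require Import structures.
From Stdlib Require Import BinInt.
Require Import Defs.
From mathcomp Require Import all_boot all_order all_algebra.
From mathcomp Require Import reals complex.
From mathcomp Require Import ssrAC ring zify ssrZ.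

Set Implicit Arguments.
Unset Strict Implicit.
Unset Printing Implicit Defensive.

Import Order.TTheory GRing.Theory Num.Theory.

Local Open Scope ring_scope.

(** * Fox derivatives of alternating words *)

Section FoxSum.
Variables (K : fieldType) (V : lmodType K) (t : K).
Implicit Types (G : nat -> V) (i n : nat) (e : bool) (u v : seq bool).

Definition sgn e : int := if e then 1 else -1.
Definition tsgn e : K := if e then t else t^-1.

(* The derivative with respect to a of the word whose letters, numbered from i,
   have exponents +1 or -1 according to u, and are a at even places and b at odd
   ones. G n is the product of the letters before place n, without the powers of
   t and without the signs of the exponents, as letters act by involutions. *)
Fixpoint fox_sum G i u : V :=
  if u is e :: u' then
    if e then (if odd i then 0 else G i) + t *: fox_sum G i.+1 u'
    else t^-1 *: (fox_sum G i.+1 u' - (if odd i then 0 else G i.+1))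
  else 0.

Definition tweight u : K := \prod_(e <- u) tsgn e.

Lemma tweight_nil : tweight [::] = 1. Proof. by rewrite /tweight big_nil. Qed.

Lemma tweight_cons e u : tweight (e :: u) = tsgn e * tweight u.
Proof. by rewrite /tweight big_cons. Qed.

Lemma tweight_cat u v : tweight (u ++ v) = tweight u * tweight v.
Proof. by rewrite /tweight big_cat. Qed.

Lemma tweight_nseq n e : tweight (nseq n e) = tsgn e ^+ n.
Proof. by elim: n => [|n IH]; rewrite ?tweight_nil //= tweight_cons IH exprS. Qed.

Lemma fox_sum_cat G i u v :
  fox_sum G i (u ++ v) = fox_sum G i u + tweight u *: fox_sum G (i + size u) v.
Proof.
elim: u i => [|[] u IH] i /=; rewrite ?tweight_nil ?tweight_cons /=.
- by rewrite add0r scale1r addn0.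
- by rewrite IH scalerDr scalerA addrA addSnnS.
- by rewrite IH addrAC scalerDr scalerA addSnnS.
Qed.

(** An even shift preserves the parity of places, hence which letters are a. *)
Lemma fox_sum_shift G n i u : ~~ odd n ->
  fox_sum G (n + i) u = fox_sum (fun m => G (n + m)%N) i u.
Proof.
move=> n_even; elim: u i => //= e u IH i.
by rewrite -addnS IH oddD (negbTE n_even).
Qed.

Lemma eq_fox_sum G G' i u : G =1 G' -> fox_sum G i u = fox_sum G' i u.
Proof. by move=> eqG; elim: u i => //= e u IH i; rewrite IH !eqG. Qed.

Lemma fox_sum_sum (I : Type) (s : seq I) (Gs : I -> nat -> V) i u :
  \sum_(k <- s) fox_sum (Gs k) i u
  = fox_sum (fun m => \sum_(k <- s) Gs k m) i u.
Proof.
elim: u i => [|[] u IH] i /=; first by rewrite big1.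
- rewrite big_split /= -scaler_sumr IH; congr (_ + _).
  by case: (odd i) => //; rewrite big1.
- rewrite -scaler_sumr sumrB IH; congr (_ *: (_ - _)).
  by case: (odd i) => //; rewrite big1.
Qed.

Lemma fox_sum0 i u : fox_sum (fun=> 0) i u = 0.
Proof.
by elim: u i => //= e u IH i; rewrite IH !if_same scaler0 subr0 addr0 scaler0 if_same.
Qed.

End FoxSum.

Lemma fox_sum_linear (K : fieldType) (V W : lmodType K) (t : K)
    (g : {linear V -> W}) (G : nat -> V) i u :
  g (fox_sum t G i u) = fox_sum t (fun m => g (G m)) i u.
Proof.
elim: u i => [|[] u IH] i /=; first by rewrite linear0.
- by rewrite linearD linearZ /= IH; case: (odd i); rewrite ?linear0.
- by rewrite linearZ linearB /= IH; case: (odd i); rewrite ?linear0.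
Qed.

(** * Words composed of alternating blocks *)

Section Blocks.
Local Open Scope nat_scope.
Implicit Types (c l k j : nat) (e : bool) (w : seq bool).

(* In w, true stands for a block of length c + 1 and false for one of length c. *)
Fixpoint blocks c w e : seq bool :=
  if w is b :: w' then nseq (c + b) e ++ blocks c w' (~~ e) else [::].

Lemma blocks_cat c w w' e :
  blocks c (w ++ w') e = blocks c w e ++ blocks c w' (odd (size w) (+) e).
Proof. by elim: w e => //= b w IH e; rewrite IH catA addNb addbN. Qed.

End Blocks.

Section Affine.
Variables (K : fieldType) (V : lmodType K) (t : K) (G : nat -> V) (l : nat).
Hypotheses (t0 : t != 0) (tl1 : t ^+ (2 * l) != 1)
  (Gper : forall i, G (2 * l + i)%N = G i).

Lemma fox_sum_per n i u : fox_sum t G (2 * l * n + i) u = fox_sum t G i u.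
Proof.
have per m : fox_sum t G (2 * l + m) u = fox_sum t G m u.
  by rewrite fox_sum_shift ?oddM //; exact: eq_fox_sum.
by elim: n => [|n IH]; rewrite ?muln0 // mulnS -addnA per.
Qed.

(** Since [G] has period 2l, each group of 2l letters repeats the same derivative, multiplied by the
    weight of the groups before it: a geometric sum. *)
Lemma fox_sum_nseq k i e :
  fox_sum t G i (nseq (2 * l * k) e)
  = (\sum_(n < k) (tsgn t e ^+ (2 * l)) ^+ n) *: fox_sum t G i (nseq (2 * l) e).
Proof.
elim: k => [|k IH]; first by rewrite muln0 big_ord0 scale0r.
rewrite mulnS addnC nseqD fox_sum_cat size_nseq [(i + _)%N]addnC fox_sum_per IH.
by rewrite tweight_nseq big_ord_recr /= scalerDl -(exprM _ (2 * l)%N).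
Qed.

Let al k := alpha l k t.

Lemma alphaE k : al k = \sum_(n < k) (t ^+ (2 * l)) ^+ n.
Proof.
by rewrite /al /alpha exprM subrX1 mulrC mulKf // subr_eq0.
Qed.

Lemma alphaS k : al k.+1 = t ^+ (2 * l) * al k + 1.
Proof.
rewrite !alphaE big_ord_recl expr0 addrC mulr_sumr; congr (_ + _).
by apply: eq_bigr => i _; rewrite exprS.
Qed.

Lemma texp_alpha k : t ^+ (2 * l * k) = 1 + al k * (t ^+ (2 * l) - 1).
Proof. by rewrite /al /alpha divfK ?subr_eq0 // addrC subrK. Qed.

Lemma alphaV k :
  t ^+ (2 * l * k) * (\sum_(n < k) (t^-1 ^+ (2 * l)) ^+ n) = t ^+ (2 * l) * al k.
Proof.
elim: k => [|k IH]; first by rewrite alphaE !big_ord0 !mulr0.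
rewrite mulnS exprD alphaS -mulrA; congr (_ * _).
rewrite big_ord_recr mulrDr IH /= -!exprM exprVn divff //.
by rewrite expf_neq0.
Qed.

(** Induction on the blocks. After a positive block the rest is multiplied by the weight t^(2lk) of
    the added letters, which is the factor required of a word starting with a negative block; there,
    it cancels the weight t^(-2lk) of the added letters. *)
Lemma fox_sum_blocks_affine c w e i : exists V0 V1 : V, forall k,
  (if e then 1 else t ^+ (2 * l * k)) *: fox_sum t G i (blocks (c + 2 * l * k) w e)
  = V0 + al k *: V1.
Proof.
elim: w e i => [|b w IH] e i /=.
  by exists 0, 0 => k; rewrite !scaler0 addr0.
have [V0 [V1 HV]] := IH (~~ e) (i + (c + b))%N.
set n := (c + b)%N in HV *; set T := t ^+ (2 * l).
pose H := fox_sum t G i (nseq (2 * l) e); pose F := fox_sum t G i (nseq n e).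
pose E := tsgn t e ^+ n.
(* The 2lk extra letters are put at the front of the block; by periodicity they affect what follows
   only through their weight. *)
have split k : fox_sum t G i (nseq (c + 2 * l * k + b) e
      ++ blocks (c + 2 * l * k) w (~~ e))
    = (\sum_(m < k) (tsgn t e ^+ (2 * l)) ^+ m) *: H
    + (tsgn t e ^+ (2 * l * k)) *: (F
      + E *: fox_sum t G (i + n) (blocks (c + 2 * l * k) w (~~ e))).
  have -> : (c + 2 * l * k + b = 2 * l * k + n)%N by rewrite addnAC addnC.
  rewrite nseqD -catA fox_sum_cat fox_sum_nseq fox_sum_cat !size_nseq !tweight_nseq.
  by rewrite [(i + 2 * l * k)%N]addnC -addnA !fox_sum_per.
case: e @H @F @E HV split => H F E /= HV split.
  exists (F + E *: V0), (H + (T - 1) *: F + E *: V1) => k.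
  rewrite scale1r split -alphaE scalerDr (scalerA _ E) [_ * E]mulrC -(scalerA E) HV.
  rewrite texp_alpha -/T; move: (T - 1) => T1.
  rewrite !scalerDl !scalerDr scale1r !scalerA [E * _]mulrC.
  by rewrite [LHS](AC (1*(2*2)) ((2*4)*(1*3*5))).
exists (F + E *: V0), (T *: H + E *: V1) => k; rewrite split.
rewrite !scalerDr !scalerA alphaV -/T exprVn divff ?expf_neq0 // mul1r !scale1r.
have := HV k; rewrite scale1r => ->.
rewrite !scalerDr !scalerA [E * _]mulrC [T * _]mulrC.
by rewrite [LHS](AC (1*(1*2)) ((2*3)*(1*4))).
Qed.

(** An affine function of alpha_k is determined by its values at alpha_0 = 0 and alpha_1 = 1. *)
Lemma fox_sum_blocks_alpha c w i k :
  fox_sum t G i (blocks (c + 2 * l * k) w true)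
  = (1 - al k) *: fox_sum t G i (blocks c w true)
    + al k *: fox_sum t G i (blocks (c + 2 * l) w true).
Proof.
have [V0 [V1 HV]] := fox_sum_blocks_affine c w true i.
have al0 : al 0 = 0 by rewrite alphaE big_ord0.
have al1 : al 1 = 1 by rewrite alphaE big_ord1 expr0.
have := HV 0; have := HV 1; have := HV k.
rewrite !scale1r al0 al1 scale0r scale1r addr0 muln0 addn0 muln1 => -> -> ->.
by rewrite scalerBl scale1r scalerDr addrA subrK.
Qed.

Lemma tweight_blocks_pairs c n e : tweight t (blocks c (nseq (2 * n) false) e) = 1.
Proof.
elim: n => [|n IH]; first exact: tweight_nil.
rewrite mulnS /= !tweight_cat !tweight_nseq negbK IH mulr1 -exprMn addn0.
by case: e {IH}; rewrite /tsgn /= ?divff ?mulVf ?expr1n.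
Qed.

Lemma size_blocks_pairs c n e :
  size (blocks c (nseq n false) e) = (c * n)%N.
Proof.
by elim: n e => [|n IH] e; rewrite ?muln0 //= size_cat size_nseq IH addn0 mulnS.
Qed.

Section Run.
Variables c : nat.
Hypothesis Gsum : forall i, \sum_(n < l) G (i + 2 * c * n)%N = 0.

(** A pair of short blocks has length 2c and, its signs being opposite, weight 1. The l pairs
    therefore contribute the derivative of one pair taken with the sum of the shifts of [G] by 2cn,
    which is 0. *)
Lemma fox_sum_period e i :
  fox_sum t G i (blocks c (nseq (2 * l) false) e) = 0.
Proof.
set W := blocks c [:: false; false] e.
have W_pow n : fox_sum t G i (blocks c (nseq (2 * n) false) e)
    = \sum_(m < n) fox_sum t G (2 * c * m + i) W.
  elim: n => [|n IH]; first by rewrite big_ord0.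
  rewrite mulnS addnC nseqD blocks_cat fox_sum_cat IH big_ord_recr /=.
  rewrite tweight_blocks_pairs scale1r size_blocks_pairs size_nseq oddM /=.
  by rewrite mulnCA mulnA [(i + _)%N]addnC.
rewrite W_pow.
under eq_bigr => m _ do rewrite fox_sum_shift ?oddM //.
rewrite fox_sum_sum (eq_fox_sum _ (G' := fun=> 0)) ?fox_sum0 // => m.
by under eq_bigr => n _ do rewrite addnC; exact: Gsum.
Qed.

(** Besides having derivative 0, the run has weight 1 and a length divisible by 2l, so [v] is read
    in the same state. *)
Lemma fox_sum_run e j i v :
  fox_sum t G i (blocks c (nseq (2 * l * j) false) e ++ v) = fox_sum t G i v.
Proof.
elim: j => [|j IH]; first by rewrite muln0.
rewrite mulnS nseqD blocks_cat size_nseq oddM /= -catA fox_sum_cat.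
rewrite fox_sum_period tweight_blocks_pairs scale1r add0r size_blocks_pairs.
by rewrite mulnC [(i + _)%N]addnC fox_sum_per IH.
Qed.

Lemma fox_sum_gaps j ds e i :
  fox_sum t G i (blocks c (flatten [seq true :: nseq (2 * l * j + d) false | d <- ds]) e)
  = fox_sum t G i (blocks c (flatten [seq true :: nseq d false | d <- ds]) e).
Proof.
elim: ds e i => //= d ds IH e i.
rewrite !fox_sum_cat; congr (_ + _ *: _).
rewrite (nseqD (2 * l * j)) -catA blocks_cat fox_sum_run.
have -> : odd (size (nseq (2 * l * j) false)) = false.
  by rewrite size_nseq -mulnA oddM.
rewrite /=.
by rewrite !blocks_cat !fox_sum_cat IH.
Qed.
End Run.
End Affine.

(** * Block structure of the signs *)

Section Signs.
Local Open Scope nat_scope.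
Implicit Types (p q r c l j k m n : nat).

(** The list starts at i = 0, always of sign +1, which completes the first block; the exponents of
    the knot word are its tail. *)
Definition signs p q : seq bool := [seq ~~ odd ((i * p) %/ q) | i <- iota 0 q].

(** Among the p blocks the long ones have the numbers floor(m p / r); each entry counts the short
    blocks that follow a long one. *)
Definition gaps p r : seq nat :=
  [seq ((m.+1 * p) %/ r - (m * p) %/ r).-1 | m <- iota 0 r].

Definition long_blocks p r : seq bool :=
  flatten [seq true :: nseq d false | d <- gaps p r].

Lemma iota_flatten (S : nat -> nat) n : S 0 = 0 ->
    {homo S : m n / m <= n} ->
  iota 0 (S n) = flatten [seq iota (S m) (S m.+1 - S m) | m <- iota 0 n].
Proof.
move=> S0 Smono; elim: n => [|n IH]; first by rewrite S0.
rewrite -[in RHS]addn1 iotaD map_cat flatten_cat -IH /= cats0 add0n.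
by rewrite -[in RHS](add0n (S n)) -iotaD subnKC // Smono.
Qed.

Lemma map_iota_flatten (T : eqType) (S : nat -> nat) (f g : nat -> T) n :
    S 0 = 0 -> {homo S : m n / m <= n} ->
    (forall m i, m < n -> S m <= i < S m.+1 -> f i = g m) ->
  [seq f i | i <- iota 0 (S n)]
  = flatten [seq nseq (S m.+1 - S m) (g m) | m <- iota 0 n].
Proof.
move=> S0 Smono fg; rewrite (iota_flatten n S0 Smono) map_flatten -map_comp.
congr flatten; apply/eq_in_map => m; rewrite mem_iota add0n => /= m_lt.
have /all_pred1P -> : all (pred1 (g m)) [seq f i | i <- iota (S m) (S m.+1 - S m)].
  apply/allP => _ /mapP[i + ->]; rewrite mem_iota subnKC ?Smono // => Si.
  by apply/eqP/fg.
by rewrite size_map size_iota.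
Qed.

(** The ceiling of n r / p. With q for r it is the first place of block n, the least i with n q <= i
    p. *)
Definition ceil_div p r n := (n * r + p.-1) %/ p.

Lemma leq_ceil_div p r m n : 0 < p -> (ceil_div p r n <= m) = (n * r <= m * p).
Proof.
move=> p0; rewrite -ltnS ltn_divLR // mulSn.
by case: p p0 => // p _; rewrite addSn ltnS addnC leq_add2l.
Qed.

Lemma ceil_div_mono p r : {homo ceil_div p r : m n / m <= n}.
Proof. by move=> m n mn; rewrite leq_div2r // leq_add2r leq_mul2r mn orbT. Qed.

Lemma blocks_iota c (b : nat -> bool) m n :
  flatten [seq nseq (c + b i) (~~ odd i) | i <- iota m n]
  = blocks c [seq b i | i <- iota m n] (~~ odd m).
Proof. by elim: n m => //= n IH m; rewrite IH. Qed.

(** Block n consists of the i with floor(i p / q) = n. Its length is c plus the increment of the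
    ceiling of n r / p, which is 0 or 1 as r < p. *)
Lemma signs_blocks c p r : 0 < r < p ->
  signs p (c * p + r)
  = blocks c [seq ceil_div p r n < ceil_div p r n.+1 | n <- iota 0 p] true.
Proof.
case/andP=> r0 rp; have p0 := ltn_trans r0 rp; set q := c * p + r.
have q0 : 0 < q by rewrite addn_gt0 r0 orbT.
have S0 : ceil_div p q 0 = 0 by rewrite /ceil_div mul0n divn_small ?prednK.
have Sp : ceil_div p q p = q.
  by rewrite /ceil_div mulnC divnMDl // divn_small ?prednK ?addn0.
rewrite /signs -{2}Sp.
rewrite (@map_iota_flatten _ _ _ (fun n => ~~ odd n) _ S0 (@ceil_div_mono p q)).
  have SE n : ceil_div p q n = c * n + ceil_div p r n.
    rewrite /ceil_div mulnDr mulnA -addnA [n * c]mulnC divnMDl //.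
  have bE n : ceil_div p q n.+1 - ceil_div p q n
      = c + (ceil_div p r n < ceil_div p r n.+1).
    have le1 : ceil_div p r n.+1 <= (ceil_div p r n).+1.
      rewrite leq_ceil_div // mulSn [X in _ <= X]mulSn leq_add ?(ltnW rp) //.
      by rewrite -leq_ceil_div.
    have := @ceil_div_mono p r n n.+1 (leqnSn n).
    by rewrite !SE mulnS; lia.
  under eq_map => n do rewrite bE.
  exact: blocks_iota.
move=> m i _ /andP[mi im]; congr (~~ odd _); apply/eqP.
rewrite eqn_leq -ltnS ltn_divLR // leq_divRL // -leq_ceil_div // mi andbT.
by rewrite ltnNge -leq_ceil_div // -ltnNge.
Qed.

(** The ceiling increases at n exactly when n r <= m p < (n + 1) r for some integer m, that is, when
    n = floor(m p / r). *)
Lemma ceil_div_long p r : 0 < r < p ->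
  [seq ceil_div p r n < ceil_div p r n.+1 | n <- iota 0 p] = long_blocks p r.
Proof.
case/andP=> r0 rp; have p0 := ltn_trans r0 rp.
pose T m := (m * p) %/ r.
have T0 : T 0 = 0 by rewrite /T mul0n div0n.
have Tr : T r = p by rewrite /T mulKn.
have Tmono : {homo T : m n / m <= n}.
  by move=> m n mn; rewrite leq_div2r // leq_mul2r mn orbT.
have T_lt m : T m < T m.+1.
  by rewrite leq_divRL // mulSn; have := leq_divM (m * p) r; rewrite -/(T m); lia.
rewrite -[X in iota 0 X]Tr (iota_flatten r T0 Tmono) map_flatten -map_comp.
rewrite /long_blocks /gaps.
rewrite -map_comp; congr flatten; apply: eq_map => m /=.
rewrite -/(T m) -/(T m.+1); have -> : T m.+1 - T m = (T m.+1 - T m).-1.+1.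
  by rewrite prednK // subn_gt0.
rewrite /=; congr (_ :: _).
  rewrite ltnNge leq_ceil_div // -ltnNge.
  apply: (@leq_ltn_trans (m * p)); last by rewrite -ltn_divLR.
  by rewrite leq_mul2r leq_ceil_div ?leq_divM ?orbT.
have /all_pred1P -> : all (pred1 false)
  [seq ceil_div p r n < ceil_div p r n.+1 | n <- iota (T m).+1 (T m.+1 - T m).-1].
  apply/allP => _ /mapP[n + ->]; rewrite mem_iota => /andP[mn nm].
  rewrite /= eqbF_neg -leqNgt leq_ceil_div //.
  have ltm : m < ceil_div p r n by rewrite ltnNge leq_ceil_div // -ltnNge -ltn_divLR.
  apply: (@leq_trans (m.+1 * p)); last by rewrite leq_mul2r ltm orbT.
  by rewrite -leq_divRL // -/(T _); move: nm (T_lt m); lia.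
by rewrite size_map size_iota.
Qed.

(** Each floor(i (p + n r) / r) equals i n + floor(i p / r), so consecutive differences grow by
    n. *)
Lemma gapsD p r n : 0 < r < p -> gaps (p + n * r) r = [seq n + d | d <- gaps p r].
Proof.
case/andP=> r0 rp; rewrite -map_comp; apply: eq_map => m /=.
have TD i : i * (p + n * r) %/ r = i * n + i * p %/ r.
  by rewrite mulnDr mulnA addnC divnMDl.
have T_lt : m * p %/ r < m.+1 * p %/ r.
  by rewrite leq_divRL // mulSn; have := leq_divM (m * p) r; lia.
by rewrite !TD mulSn; lia.
Qed.
End Signs.

(** * Fox derivatives of the knot word *)

Lemma fox_sum_signs (K : fieldType) (V : lmodType K) (t : K) (G : nat -> V)
    (l a r p j k : nat) :
    t != 0 -> t ^+ (2 * l) != 1 -> (forall i, G (2 * l + i)%N = G i) ->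
    j = 0%N \/ (forall i, \sum_(n < l) G (i + 2 * a * n)%N = 0) ->
    (0 < r < p)%N ->
  fox_sum t G 0 (signs (p + 2 * l * j * r) ((a + 2 * l * k) * (p + 2 * l * j * r) + r))
  = (1 - alpha l k t) *: fox_sum t G 0 (signs p (a * p + r))
    + alpha l k t *: fox_sum t G 0 (signs p ((a + 2 * l) * p + r)).
Proof.
move=> t0 tl1 Gper Gsum /[dup] rp /andP[r0 r_lt].
have rp' : (0 < r < p + 2 * l * j * r)%N by rewrite r0 ltn_addr.
rewrite !signs_blocks // !ceil_div_long //.
(* The inserted short blocks are removed first, at block length a + 2lk; then comes the
   interpolation in alpha_k. *)
suff -> : fox_sum t G 0 (blocks (a + 2 * l * k) (long_blocks (p + 2 * l * j * r) r) true)
  = fox_sum t G 0 (blocks (a + 2 * l * k) (long_blocks p r) true).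
  exact: fox_sum_blocks_alpha.
case: Gsum => [->|Gsum]; first by rewrite muln0 mul0n addn0.
rewrite /long_blocks gapsD // -map_comp.
(* By periodicity of [G] these sums depend on a modulo l only. *)
have Gsum' i : \sum_(n < l) G (i + 2 * (a + 2 * l * k) * n)%N = 0.
  rewrite -[RHS](Gsum i); apply: eq_bigr => n _.
  have -> : (i + 2 * (a + 2 * l * k) * n = 2 * l * (2 * k * n) + (i + 2 * a * n))%N.
    by lia.
  elim: (2 * k * n)%N => [|m IH]; first by rewrite muln0.
  by rewrite mulnS -addnA Gper.
exact: (fox_sum_gaps t0 Gper Gsum' j).
Qed.

Lemma signs_behead p q : (0 < q)%N -> signs p q = true :: behead (signs p q).
Proof. by case: q => // q _; rewrite /signs /= mul0n div0n. Qed.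

Fixpoint alt_word (i : nat) (u : seq bool) : word :=
  if u is e :: u' then (if odd i then gb else ga, e) :: alt_word i.+1 u' else [::].

Lemma alt_word_map (f : nat -> bool) i n :
  alt_word i [seq f m | m <- iota i n]
  = [seq (if odd m then gb else ga, f m) | m <- iota i n].
Proof. by elim: n i => //= n IH i; rewrite IH. Qed.

Lemma behead_signs p q :
  behead (signs p q) = [seq ~~ odd ((m * p) %/ q) | m <- iota 1 q.-1].
Proof. by rewrite /signs; case: q. Qed.

Lemma knot_wordE p q : knot_word p q = alt_word 1 (behead (signs p q)).
Proof.
rewrite behead_signs alt_word_map; apply: eq_map => i.
by rewrite /eps -signr_odd; case: (odd (_ %/ _)%N).
Qed.

Section Fox.
Variables (K : fieldType) (n : nat) (t : K) (s r : 'M[K]_n).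
Hypotheses (t0 : t != 0) (ss : s *m s = 1%:M) (rr : r *m r = 1%:M).

(** The value s at 0 makes the product s s = 1 at place 1, where the knot word starts. *)
Fixpoint alt_prod (i : nat) : 'M[K]_n :=
  if i is j.+1 then alt_prod j *m (if odd j then r else s) else s.

Lemma invmx_scale_invol (x : 'M[K]_n) : x *m x = 1%:M -> invmx (t *: x) = t^-1 *: x.
Proof.
move=> xx; have Ux : t *: x *m (t^-1 *: x) = 1%:M.
  by rewrite -scalemxAl -scalemxAr scalerA divff // scale1r.
have [U _] := mulmx1_unit Ux.
by rewrite -[RHS](mulKmx U) Ux mulmx1.
Qed.

Lemma eval_gring_cat A B (y z : seq (int * word)) :
  @eval_gring K n A B (y ++ z) = eval_gring A B y + eval_gring A B z.
Proof. by rewrite /eval_gring big_cat. Qed.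

Lemma eval_gring_cons A B x (y : seq (int * word)) :
  @eval_gring K n A B [seq (z.1, x :: z.2) | z <- y]
  = eval_letter A B x *m eval_gring A B y.
Proof.
rewrite /eval_gring big_map mulmx_sumr; apply: eq_bigr => z _ /=.
by rewrite -!scaler_int scalemxAr.
Qed.

(** The product rule, letter by letter. As s and r are involutions, the inverse of a letter is 1/t
    times the same matrix. *)
Lemma eval_fox_alt i u :
  alt_prod i *m eval_gring (t *: s) (t *: r) (fox ga (alt_word i u))
  = fox_sum t alt_prod i u.
Proof.
elim: u i => [|e u IH] i.
  by rewrite /= /eval_gring big_nil mulmx0.
rewrite [fox _ _]/= eval_gring_cat eval_gring_cons mulmxDr mulmxA.
have -> : eval_letter (t *: s) (t *: r) (if odd i then gb else ga, e)
    = tsgn t e *: (if odd i then r else s).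
  by rewrite /eval_letter /tsgn; case: (odd i) e => -[] //=; rewrite invmx_scale_invol.
rewrite -scalemxAr -scalemxAl -[alt_prod i *m (if _ then _ else _)]/(alt_prod i.+1) IH.
have -> : eval_gring (t *: s) (t *: r) (if (if odd i then gb else ga) == ga then
    [:: if e then (1, [::]) else (-1, [:: (if odd i then gb else ga, false)])] else [::])
  = if odd i then 0 else if e then 1%:M else - (t^-1 *: s).
  case: (odd i) => /=; first by rewrite /eval_gring big_nil.
  rewrite /eval_gring big_seq1; case: e; rewrite //= mulmx1 /eval_letter /=.
  by rewrite invmx_scale_invol // mulrN1z.
case: e => /=; case: (odd i) => //; rewrite ?mulmx0 ?mulmx1 ?subr0 ?add0r //.
by rewrite mulmxN -scalemxAr scalerBr addrC.
Qed.

Lemma fox_knot_word p q :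
  eval_gring (t *: s) (t *: r) (fox ga (knot_word p q))
  = fox_sum t alt_prod 1 (behead (signs p q)).
Proof. by rewrite knot_wordE -eval_fox_alt /= ss mul1mx. Qed.

End Fox.

(** * The Alexander polynomial from the trivial representation *)

Definition alex_sum (K : fieldType) (t : K) (u : seq bool) : K :=
  1 + (t - 1) * fox_sum t (fun=> 1 : K^o) 1 u.

Section Alexander.
Variables (K : fieldType) (t : K).
Hypothesis (t0 : t != 0).

Fixpoint alt_sum (u : seq bool) : K :=
  if u is e :: u' then 1 - tsgn t e * alt_sum u' else 1.

(** A letter a of exponent e after a prefix of weight x adds x (t^e - 1) to t - 1 times the
    derivative; these differences pair the terms of the alternating sum. By the parity condition a
    nonempty word ends with a letter a. *)
Lemma alt_sumE i u : odd i = ~~ odd (size u) ->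
  alt_sum u = (if odd i then 1 else 0)
    + (if odd i then 1 else -1) * (t - 1) * fox_sum t (fun=> 1 : K^o) i u.
Proof.
elim: u i => [|e u IH] i /= par.
  by rewrite par /= mulr0 addr0.
rewrite (IH i.+1) /=; last by rewrite par negbK.
rewrite /GRing.scale /= /tsgn.
by case: e; case: (odd _) => /=; rewrite ?add0r ?subr0; field.
Qed.

Lemma alt_sum_big (e : nat -> bool) i n :
  alt_sum [seq e m | m <- iota i n]
  = \sum_(0 <= m < n.+1) (-1) ^+ m * t ^ (\sum_(i <= h < i + m) sgn (e h)).
Proof.
elim: n i => [|n IH] i /=.
  by rewrite big_nat1 addn0 big_geq // mulr1.
rewrite big_nat_recl // addn0 big_geq // mulr1 IH; congr (_ + _).
rewrite big_distrr -sumrN; apply: eq_big_nat => m _ /=.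
rewrite exprS mulN1r mulNr mulrCA; congr (- (_ * _)).
rewrite [in RHS]big_ltn ?addnS ?ltnS ?leq_addr // expfzDr // addSn; congr (_ * _).
by rewrite /tsgn /sgn; case: (e i).
Qed.

Lemma alexanderE p q : odd q ->
  alexander p q t = alex_sum t (behead (signs p q)).
Proof.
rewrite /alex_sum => q_odd; have q0 : (0 < q)%N by case: q q_odd.
have := @alt_sumE 1 (behead (signs p q)).
rewrite size_behead size_map size_iota -subn1 oddB // q_odd mul1r => <- //.
rewrite behead_signs alt_sum_big prednK // /alexander.
apply: eq_bigr => i _; congr (_ * t ^ _).
apply: eq_bigr => h _; rewrite /eps /sgn -signr_odd.
by case: (odd _).
Qed.

End Alexander.

(** * Two-dimensional representations *)

(** Removing the first letter is an affine operation, and the coefficients 1 - alpha_k and alpha_k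
    sum to 1. *)
Lemma fox_sum_signs1 (K : fieldType) (V : lmodType K) (t : K) (G : nat -> V)
    (l a r p j k : nat) :
    t != 0 -> t ^+ (2 * l) != 1 -> (forall i, G (2 * l + i)%N = G i) ->
    j = 0%N \/ (forall i, \sum_(n < l) G (i + 2 * a * n)%N = 0) ->
    (0 < r < p)%N ->
  fox_sum t G 1
    (behead (signs (p + 2 * l * j * r) ((a + 2 * l * k) * (p + 2 * l * j * r) + r)))
  = (1 - alpha l k t) *: fox_sum t G 1 (behead (signs p (a * p + r)))
    + alpha l k t *: fox_sum t G 1 (behead (signs p ((a + 2 * l) * p + r))).
Proof.
move=> t0 tl1 Gper Gsum /[dup] rp /andP[r0 _].
have FE p' q' : (0 < q')%N ->
    fox_sum t G 1 (behead (signs p' q')) = t^-1 *: (fox_sum t G 0 (signs p' q') - G 0%N).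
  move=> q0; rewrite (signs_behead p' q0) /= [G _ + _]addrC addrK scalerA.
  by rewrite mulVf ?scale1r.
rewrite !FE ?addn_gt0 ?r0 ?orbT // fox_sum_signs //.
have scaleC k' (x : V) : k' *: (t^-1 *: x) = t^-1 *: (k' *: x).
  by rewrite !scalerA mulrC.
rewrite !scaleC -scalerDr; congr (_ *: _).
by rewrite !scalerBr addrACA -opprD -scalerDl subrK scale1r.
Qed.

Section Mx2.
Variable K : fieldType.
Implicit Types a b c d : K.

Definition mx2 a b c d : 'M[K]_2 :=
  \matrix_(i, j) if i == 0 then (if j == 0 then a else b)
                 else (if j == 0 then c else d).

Lemma mx2P (M N : 'M[K]_2) : M 0 0 = N 0 0 -> M 0 1 = N 0 1 ->
  M 1 0 = N 1 0 -> M 1 1 = N 1 1 -> M = N.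
Proof.
move=> e00 e01 e10 e11; apply/matrixP => i j.
have I2 (k : 'I_2) : k = 0 \/ k = 1.
  by case: k => [[|[|//]] ?]; [left|right]; exact: val_inj.
by case: (I2 i) => ->; case: (I2 j) => ->.
Qed.

Lemma mul_mx2 a b c d a' b' c' d' : mx2 a b c d *m mx2 a' b' c' d'
  = mx2 (a * a' + b * c') (a * b' + b * d') (c * a' + d * c') (c * b' + d * d').
Proof. by apply: mx2P; rewrite !mxE !big_ord_recl big_ord0 !mxE /= addr0. Qed.

Lemma add_mx2 a b c d a' b' c' d' :
  mx2 a b c d + mx2 a' b' c' d' = mx2 (a + a') (b + b') (c + c') (d + d').
Proof. by apply: mx2P; rewrite !mxE. Qed.

Lemma scale_mx2 k a b c d : k *: mx2 a b c d = mx2 (k * a) (k * b) (k * c) (k * d).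
Proof. by apply: mx2P; rewrite !mxE. Qed.

Lemma one_mx2 : 1%:M = mx2 1 0 0 1.
Proof. by apply: mx2P; rewrite !mxE. Qed.

Lemma det_mx2 a b c d : \det (mx2 a b c d) = a * d - b * c.
Proof.
rewrite (expand_det_row _ 0) !big_ord_recl big_ord0 /cofactor !det_mx11 !mxE /=.
by rewrite expr0 expr1 mul1r mulN1r mulrN addr0. Qed.

End Mx2.

Section FoxMx.
Variables (K : fieldType) (t : K).

(** The matrix whose determinant is the numerator of the twisted Alexander polynomial, for a = t s
    and b = t r. *)
Definition fox_mx n (s r : 'M[K]_n) (u : seq bool) : 'M[K]_n :=
  1%:M + (t *: s - 1%:M) *m fox_sum t (alt_prod s r) 1 u.

Lemma alt_prod_conj m n (T : 'M[K]_(m, n)) s r s' r' i :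
    T *m s = s' *m T -> T *m r = r' *m T ->
  T *m alt_prod s r i = alt_prod s' r' i *m T.
Proof.
move=> Ts Tr; elim: i => [|i IH] //=.
by rewrite mulmxA IH -!mulmxA; case: (odd i); rewrite ?Ts ?Tr.
Qed.

(** [T] may be rectangular: its rows then span an invariant subspace, on which s' and r' describe
    the action. *)
Lemma fox_mx_conj m n (T : 'M[K]_(m, n)) s r s' r' u :
    T *m s = s' *m T -> T *m r = r' *m T ->
  T *m fox_mx s r u = fox_mx s' r' u *m T.
Proof.
move=> Ts Tr; rewrite /fox_mx mulmxDr mulmxDl mulmx1 mul1mx; congr (_ + _).
rewrite mulmxA mulmxBr mulmx1 -scalemxAr Ts.
have -> : t *: (s' *m T) - T = (t *: s' - 1%:M) *m T.
  by rewrite mulmxBl mul1mx scalemxAl.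
rewrite -!mulmxA; congr (_ *m _).
rewrite -[LHS]/(mulmx T _) -[RHS]/(mulmxr T _) !fox_sum_linear.
by apply: eq_fox_sum => k /=; exact: alt_prod_conj.
Qed.

Lemma fox_mx_affine n (s r : 'M[K]_n) (l a r' p j k : nat) :
    t != 0 -> t ^+ (2 * l) != 1 ->
    (forall i, alt_prod s r (2 * l + i) = alt_prod s r i) ->
    j = 0%N \/ (forall i, \sum_(n < l) alt_prod s r (i + 2 * a * n) = 0) ->
    (0 < r' < p)%N ->
  fox_mx s r
    (behead (signs (p + 2 * l * j * r') ((a + 2 * l * k) * (p + 2 * l * j * r') + r')))
  = (1 - alpha l k t) *: fox_mx s r (behead (signs p (a * p + r')))
    + alpha l k t *: fox_mx s r (behead (signs p ((a + 2 * l) * p + r'))).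
Proof.
move=> t0 tl1 Gper Gsum rp; rewrite /fox_mx fox_sum_signs1 //.
rewrite mulmxDr -!scalemxAr !scalerDr addrACA -scalerDl subrK scale1r.
by [].
Qed.
End FoxMx.

Section Dihedral2.
Variables (K : fieldType) (t mu : K) (l : nat).
Hypotheses (t0 : t != 0) (tl1 : t ^+ (2 * l) != 1)
  (mul1 : mu ^+ l = 1) (l_odd : odd l).

Definition diag_s := mx2 0 mu mu^-1 0.
Definition diag_r := mx2 (0 : K) 1 1 0.

Let mu0 : mu != 0.
Proof.
apply: contra_eq_neq mul1 => ->; rewrite expr0n.
by case: l l_odd => // n _; rewrite eq_sym oner_eq0.
Qed.

Lemma diag_sr : diag_s *m diag_r = mx2 mu 0 0 mu^-1.
Proof. by rewrite mul_mx2; congr mx2; ring. Qed.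

Lemma diag_rs : diag_r *m diag_s = mx2 mu^-1 0 0 mu.
Proof. by rewrite mul_mx2; congr mx2; ring. Qed.

Lemma alt_prod_diag i m : alt_prod diag_s diag_r (i + 2 * m)
  = alt_prod diag_s diag_r i *m
    (if odd i then mx2 (mu^-1 ^+ m) 0 0 (mu ^+ m) else mx2 (mu ^+ m) 0 0 (mu^-1 ^+ m)).
Proof.
elim: m => [|m IH].
  by rewrite muln0 addn0 !expr0 -one_mx2 if_same mulmx1.
have par : odd (i + 2 * m) = odd i by rewrite oddD oddM addbF.
rewrite mulnS addnCA /= IH par -!mulmxA; congr (_ *m _).
rewrite !exprSr.
by case: (odd i); rewrite /= ?diag_rs ?diag_sr !mul_mx2 !mul0r !mulr0 !add0r !addr0.
Qed.

Lemma alt_prod_diag_per i :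
  alt_prod diag_s diag_r (2 * l + i) = alt_prod diag_s diag_r i.
Proof. by rewrite addnC alt_prod_diag exprVn mul1 invr1 -one_mx2 if_same mulmx1. Qed.

(** The sum contains a diagonal factor whose entries are geometric sums of powers of mu^a and
    mu^(-a), nontrivial l-th roots of unity. *)
Lemma alt_prod_diag_sum a i : mu ^+ a != 1 ->
  \sum_(n < l) alt_prod diag_s diag_r (i + 2 * a * n) = 0.
Proof.
move=> mua; under eq_bigr => n _ do rewrite -mulnA alt_prod_diag.
rewrite -mulmx_sumr.
have geo (x : K) : x ^+ a != 1 -> x ^+ l = 1 -> \sum_(n < l) x ^+ (a * n) = 0.
  move=> xa xl; have /eqP := subrX1 (x ^+ a) l.
  rewrite -exprM mulnC exprM xl expr1n subrr eq_sym mulf_eq0 subr_eq0 (negbTE xa) /=.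
  by move=> /eqP Hs; rewrite -[RHS]Hs; apply: eq_bigr => n _; rewrite exprM.
have sum_mx (f g : nat -> K) : \sum_(n < l) mx2 (f n) 0 0 (g n)
    = mx2 (\sum_(n < l) f n) 0 0 (\sum_(n < l) g n).
  elim: l => [|n IH]; first by rewrite !big_ord0; apply: mx2P; rewrite !mxE.
  by rewrite !big_ord_recr /= IH add_mx2 !addr0.
have muVa : mu^-1 ^+ a != 1 by rewrite exprVn invr_eq1.
have muVl : mu^-1 ^+ l = 1 by rewrite exprVn mul1 invr1.
have mx0 : mx2 (0 : K) 0 0 0 = 0 by apply: mx2P; rewrite !mxE.
pose f (x : K) n := x ^+ (a * n).
by case: (odd i); rewrite (sum_mx (f _) (f _)) !geo // mx0 mulmx0.
Qed.

(* The matrices diag_s and diag_r in another basis, where the entries lie in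
   Z[c] with c = mu + 1/mu. *)
Definition real_s := mx2 (0 : K) 1 1 0.
Definition real_r (c : K) := mx2 1 c 0 (-1).

Lemma det_fox_mx2 a r p j k : mu != 1 -> j = 0%N \/ mu ^+ a != 1 -> (0 < r < p)%N ->
  \det (fox_mx t diag_s diag_r
    (behead (signs (p + 2 * l * j * r) ((a + 2 * l * k) * (p + 2 * l * j * r) + r))))
  = \det ((1 - alpha l k t) *:
        fox_mx t real_s (real_r (mu + mu^-1)) (behead (signs p (a * p + r)))
      + alpha l k t *:
        fox_mx t real_s (real_r (mu + mu^-1)) (behead (signs p ((a + 2 * l) * p + r)))).
Proof.
move=> mu1 j0 rp; rewrite (fox_mx_affine _ t0 tl1 alt_prod_diag_per) //; last first.
  by case: j0 => [|mua]; [left | right=> i; exact: alt_prod_diag_sum].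
(* The vanishing of sums was seen in the diagonal form; [T] passes to the form with entries in Z[c].
   Its determinant 1/mu - mu is nonzero: mu^2 = 1 and mu^l = 1 with l odd would give mu = 1. *)
pose T := mx2 (- mu^-1) mu 1 (-1).
have detT : \det T != 0.
  rewrite det_mx2 mulr1 mulrNN mulr1 subr_eq0; apply: contraNneq mu1 => muV.
  have mu2 : mu ^+ 2 = 1 by rewrite expr2 -{1}muV mulVf.
  rewrite -mul1 -(odd_double_half l) l_odd -mul2n exprD exprM mu2 expr1n mulr1.
  by rewrite expr1.
have Ts : T *m diag_s = real_s *m T.
  rewrite !mul_mx2 !mulr0 !mul0r !mul1r !addr0 !add0r.
  by rewrite mulNr mulVf // divff // mulN1r.
have Tr : T *m diag_r = real_r (mu + mu^-1) *m T.
  rewrite !mul_mx2 !mulr0 !mul0r !mul1r !mulr1 !addr0 !add0r ?mulN1r ?opprK.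
  congr mx2; ring.
apply: (mulfI detT); rewrite -!det_mulmx mulmxDr -!scalemxAr.
rewrite !(fox_mx_conj t _ Ts Tr) !scalemxAl -mulmxDl !det_mulmx.
exact: mulrC.
Qed.

End Dihedral2.

(** * Symbolic computation *)

(** Raw operations for computation, without ring laws: soundness needs only an evaluation into a
    field, and [iszero] is a one-sided test. *)
Record ring_ops := RingOps {
  car :> Type;
  rint : Z -> car;
  radd : car -> car -> car;
  rmul : car -> car -> car;
  iszero : car -> bool }.

Arguments rint {_}.
Arguments radd {_}.
Arguments rmul {_}.
Arguments iszero {_}.

Record eval_spec (O : ring_ops) (K : fieldType) (ev : O -> K) : Prop := EvalSpec {
  ev_int : forall z, ev (rint z) = (int_of_Z z)%:~R;
  ev_add : {morph ev : x y / radd x y >-> x + y};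
  ev_mul : {morph ev : x y / rmul x y >-> x * y};
  ev_zero : forall x, iszero x -> ev x = 0 }.

(* Integers modulo d, without reduction; d = 0 is allowed. *)
Definition int_ops (d : Z) : ring_ops :=
  @RingOps Z id Z.add Z.mul (fun z => Z.eqb z (Z.mul d (Z.div z d))).

Definition int_ev (K : fieldType) (z : Z) : K := (int_of_Z z)%:~R.

Lemma int_ops_spec d (K : fieldType) : int_ev K d = 0 ->
  @eval_spec (int_ops d) K (int_ev K).
Proof.
rewrite /int_ev => d0; split=> //= [x y|x y|x /Z.eqb_eq ->].
- by rewrite -[Z.add x y]/(x + y) rmorphD /= rmorphD.
- by rewrite -[Z.mul x y]/(x * y) rmorphM /= rmorphM.
- by rewrite -[Z.mul d _]/(d * _) rmorphM /= rmorphM /= d0 mul0r.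
Qed.

Section PolyOps.
Variables (O : ring_ops) (shift : seq O -> seq O).
Implicit Types (u v : seq O).

Fixpoint padd u v : seq O :=
  match u, v with
  | [::], _ => v
  | _, [::] => u
  | a :: u', b :: v' => radd a b :: padd u' v'
  end.

Definition pscale (a : O) v : seq O :=
  if iszero a then [::] else [seq rmul a b | b <- v].

Fixpoint pmul u v : seq O :=
  if u is a :: u' then padd (pscale a v) (shift (pmul u' v)) else [::].

(* Coefficients by increasing degree; shift is multiplication by the variable. *)
Definition poly_ops : ring_ops :=
  @RingOps (seq O) (fun z => [:: rint z]) padd pmul (all iszero).

Variables (K : fieldType) (ev : O -> K) (x : K).

Definition pev u : K := foldr (fun a y => ev a + x * y) 0 u.

Hypotheses (evP : eval_spec ev) (shiftE : forall u, pev (shift u) = x * pev u).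

Lemma pev_add u v : pev (padd u v) = pev u + pev v.
Proof.
elim: u v => [|a u IH] [|b v] /=; rewrite ?add0r ?addr0 //.
by rewrite IH (ev_add evP) mulrDr addrACA.
Qed.

Lemma pev_map_mul a v : pev [seq rmul a b | b <- v] = ev a * pev v.
Proof.
elim: v => [|b v IH] /=; first by rewrite mulr0.
by rewrite IH (ev_mul evP) mulrDr mulrCA.
Qed.

Lemma pev_scale a v : pev (pscale a v) = ev a * pev v.
Proof.
rewrite /pscale; case: ifP => [/(ev_zero evP) ->|_]; first by rewrite mul0r.
exact: pev_map_mul.
Qed.

Lemma poly_ops_spec : @eval_spec poly_ops K pev.
Proof.
split=> /= [z|u v|u v|u].
- by rewrite mulr0 addr0 (ev_int evP).
- exact: pev_add.
- elim: u => [|a u IH] /=; first by rewrite mul0r.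
  by rewrite pev_add pev_scale shiftE IH mulrDl mulrA.
- by elim: u => //= a u IH /andP[/(ev_zero evP) -> /IH ->]; rewrite mulr0 addr0.
Qed.

End PolyOps.

Definition shift_poly (O : ring_ops) (u : seq O) : seq O :=
  if u is [::] then [::] else rint Z0 :: u.

Lemma shift_polyE (O : ring_ops) (K : fieldType) (ev : O -> K) x u : eval_spec ev ->
  pev ev x (shift_poly u) = x * pev ev x u.
Proof.
by move=> evP; case: u => [|a u] /=; rewrite ?mulr0 // (ev_int evP) add0r.
Qed.

(* Multiplication by c in Z[c], where c^(size rel) is the combination of lower
   powers with coefficient sequence rel. *)
Definition shift_quo (O : ring_ops) (rel u : seq O) : seq O :=
  if size u == size rel then
    padd (rint Z0 :: take (size rel).-1 u)
         [seq rmul (last (rint Z0) u) b | b <- rel]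
  else rint Z0 :: u.

Lemma shift_quoE (O : ring_ops) (K : fieldType) (ev : O -> K) x rel u :
    eval_spec ev -> (0 < size rel)%N -> pev ev x rel = x ^+ size rel ->
  pev ev x (shift_quo rel u) = x * pev ev x u.
Proof.
move=> evP rel0 relE; rewrite /shift_quo; case: eqP => [su|_]; last first.
  by rewrite /= (ev_int evP) add0r.
case/lastP: u su rel0 => [<- //|u b]; rewrite size_rcons => su _.
rewrite (pev_add _ evP) (pev_map_mul _ evP) last_rcons relE -su /=.
rewrite (ev_int evP) add0r -cats1 take_size_cat //.
have -> : pev ev x (u ++ [:: b]) = pev ev x u + x ^+ size u * ev b.
  elim: u {su} => [|a u IH] /=; first by rewrite mulr0 addr0 add0r mul1r.
  by rewrite IH mulrDr addrA mulrA exprS.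
by rewrite mulrDr mulrA -exprS [ev b * _]mulrC.
Qed.

Section SymbolicFox.
Variables (O : ring_ops) (t al : O).

Definition sym0 : O := rint Z0.
Definition sym1 : O := rint (Zpos xH).
Definition sym_sub (x y : O) : O := radd x (rmul (rint (Zneg xH)) y).
Definition sym_exp (x : O) (n : nat) : O := ssrnat.iter n (rmul x) sym1.

Definition sym_mx := (O * O * O * O)%type.
Definition mmul (x y : sym_mx) : sym_mx :=
  let: (a, b, c, d) := x in let: (a', b', c', d') := y in
  (radd (rmul a a') (rmul b c'), radd (rmul a b') (rmul b d'),
   radd (rmul c a') (rmul d c'), radd (rmul c b') (rmul d d')).
Definition mscale (k : O) (x : sym_mx) : sym_mx :=
  let: (a, b, c, d) := x in (rmul k a, rmul k b, rmul k c, rmul k d).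
Definition madd (x y : sym_mx) : sym_mx :=
  let: (a, b, c, d) := x in let: (a', b', c', d') := y in
  (radd a a', radd b b', radd c c', radd d d').
Definition mopp (x : sym_mx) : sym_mx := mscale (rint (Zneg xH)) x.
Definition mdet (x : sym_mx) : O :=
  let: (a, b, c, d) := x in sym_sub (rmul a d) (rmul b c).
Definition mone : sym_mx := (sym1, sym0, sym0, sym1).
Definition mzero : sym_mx := (sym0, sym0, sym0, sym0).

Variables s r : sym_mx.

(* A pair (o, P) stands for t^-o P; g is the product of the letters read so
   far. *)
Fixpoint sym_fox (i : bool) (g : sym_mx) (u : seq bool) : nat * sym_mx :=
  if u is e :: u' then
    let g' := mmul g (if i then r else s) in
    let: (o, P) := sym_fox (~~ i) g' u' in
    if e then
      let: (o, P) := if o is o'.+1 then (o', P) else (0%N, mscale t P) in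
      (o, if i then P else madd P (mscale (sym_exp t o) g))
    else (o.+1, if i then P else madd P (mopp (mscale (sym_exp t o) g')))
  else (0%N, mzero).

Definition sym_fox_mx (u : seq bool) : nat * sym_mx :=
  let: (o, P) := sym_fox true mone u in
  (o, madd (mscale (sym_exp t o) mone) (madd (mmul (mscale t s) P) (mopp P))).

(** The interpolation of both results over the common denominator t^(o0 + o1). *)
Definition sym_fox_mx_alpha (u0 u1 : seq bool) : nat * sym_mx :=
  let: (o0, P0) := sym_fox_mx u0 in
  let: (o1, P1) := sym_fox_mx u1 in
  ((o0 + o1)%N, madd (mscale (rmul (sym_sub sym1 al) (sym_exp t o1)) P0)
                     (mscale (rmul al (sym_exp t o0)) P1)).

Definition sym_poly (c : seq (int * nat)) : O :=
  foldr (fun y v => radd (rmul (rint (Z_of_int y.1)) (sym_exp t y.2)) v) sym0 c.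

Variables (K : fieldType) (ev : O -> K).
Hypotheses (evP : eval_spec ev) (t0 : ev t != 0).

Definition mev (x : sym_mx) : 'M[K]_2 :=
  let: (a, b, c, d) := x in mx2 (ev a) (ev b) (ev c) (ev d).

Lemma ev_sym0 : ev sym0 = 0. Proof. by rewrite (ev_int evP). Qed.
Lemma ev_sym1 : ev sym1 = 1. Proof. by rewrite (ev_int evP). Qed.
Lemma ev_rintN1 : ev (rint (Zneg xH)) = -1. Proof. by rewrite (ev_int evP). Qed.
Lemma ev_sym_sub x y : ev (sym_sub x y) = ev x - ev y.
Proof. by rewrite (ev_add evP) (ev_mul evP) ev_rintN1 mulN1r. Qed.
Lemma ev_sym_exp x n : ev (sym_exp x n) = ev x ^+ n.
Proof. by elim: n => [|n IH]; rewrite ?ev_sym1 //= (ev_mul evP) IH exprS. Qed.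

Lemma mev_mul x y : mev (mmul x y) = mev x *m mev y.
Proof.
case: x y => [[[a b] c] d] [[[a' b'] c'] d'] /=.
by rewrite mul_mx2 !(ev_add evP) !(ev_mul evP).
Qed.
Lemma mev_scale k x : mev (mscale k x) = ev k *: mev x.
Proof. by case: x => [[[a b] c] d] /=; rewrite scale_mx2 !(ev_mul evP). Qed.
Lemma mev_add x y : mev (madd x y) = mev x + mev y.
Proof.
case: x y => [[[a b] c] d] [[[a' b'] c'] d'] /=.
by rewrite add_mx2 !(ev_add evP).
Qed.
Lemma mev_opp x : mev (mopp x) = - mev x.
Proof. by rewrite mev_scale ev_rintN1 scaleN1r. Qed.
Lemma ev_det x : ev (mdet x) = \det (mev x).
Proof. by case: x => [[[a b] c] d] /=; rewrite det_mx2 ev_sym_sub !(ev_mul evP). Qed.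
Lemma mev_one : mev mone = 1%:M.
Proof. by rewrite /= ev_sym0 ev_sym1 one_mx2. Qed.
Lemma mev_zero : mev mzero = 0.
Proof. by rewrite /= ev_sym0; apply: mx2P; rewrite !mxE. Qed.

Lemma sym_foxE i g u : mev g = alt_prod (mev s) (mev r) i ->
  let: (o, P) := sym_fox (odd i) g u in
  mev P = ev t ^+ o *: fox_sum (ev t) (alt_prod (mev s) (mev r)) i u.
Proof.
elim: u i g => [|e u IH] i g gE; first by apply: (etrans mev_zero); rewrite scaler0.
have g'E : mev (mmul g (if odd i then r else s)) = alt_prod (mev s) (mev r) i.+1.
  by rewrite mev_mul gE /=; case: (odd i).
have := IH i.+1 _ g'E; rewrite [odd i.+1]/= [sym_fox _ _ (_ :: _)]/=.
move: g'E; set g' := mmul _ _ => g'E; case: (sym_fox _ _ _) => o P PE.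
case: e => /=.
  set G := if odd i then 0 else _.
  (* Multiplication by t lowers the denominator exponent, or acts on the matrix when that exponent
     is 0. *)
  have [o' [P' [-> P'E]]] : exists o' P',
      (if o is o'.+1 then (o', P) else (0%N, mscale t P)) = (o', P') /\
      mev P' = ev t ^+ o' *: (ev t *: fox_sum (ev t) (alt_prod (mev s) (mev r)) i.+1 u).
    case: o PE => [|o] PE.
      by exists 0%N, (mscale t P); split=> //; rewrite mev_scale PE !scale1r.
    by exists o, P; split=> //; rewrite PE scalerA exprSr.
  rewrite scalerDr -P'E /G; case: (odd i); first by rewrite scaler0 add0r.
  by rewrite mev_add mev_scale ev_sym_exp gE addrC.
rewrite exprS mulrC -scalerA [_ *: (_ *: (_ - _))]scalerA divff // scale1r.
rewrite scalerBr -PE; move: g'E => /=; case: (odd i) => g'E.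
  by rewrite scaler0 subr0.
by rewrite mev_add mev_opp mev_scale ev_sym_exp g'E.
Qed.

Lemma sym_fox_mxE u : mev s *m mev s = 1%:M ->
  let: (o, P) := sym_fox_mx u in mev P = ev t ^+ o *: fox_mx (ev t) (mev s) (mev r) u.
Proof.
move=> ss; have G1 : mev mone = alt_prod (mev s) (mev r) 1 by rewrite mev_one /= ss.
have := sym_foxE u G1; rewrite /sym_fox_mx [odd 1]/=; case: (sym_fox _ _ _) => o P PE.
rewrite !mev_add mev_scale mev_mul mev_opp mev_scale mev_one ev_sym_exp /fox_mx PE.
by rewrite mulmxBl mul1mx scalerDr scalerBr scalemxAr.
Qed.

Lemma sym_fox_mx_alphaE u0 u1 : mev s *m mev s = 1%:M ->
  let: (o, P) := sym_fox_mx_alpha u0 u1 in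
  mev P = ev t ^+ o *: ((1 - ev al) *: fox_mx (ev t) (mev s) (mev r) u0
                        + ev al *: fox_mx (ev t) (mev s) (mev r) u1).
Proof.
move=> ss; rewrite /sym_fox_mx_alpha.
have := sym_fox_mxE u0 ss; have := sym_fox_mxE u1 ss.
case: (sym_fox_mx u1) => o1 P1 E1; case: (sym_fox_mx u0) => o0 P0 E0.
cbv beta iota.
rewrite mev_add !mev_scale E0 E1 !(ev_mul evP) ev_sym_sub ev_sym1 !ev_sym_exp.
rewrite [RHS]scalerDr !scalerA exprD.
by congr (_ *: _ + _ *: _); ring.
Qed.

Lemma ev_sym_poly c : ev (sym_poly c) = poly_value c (ev t).
Proof.
rewrite /poly_value; elim: c => [|y c IH]; first by rewrite big_nil ev_sym0.
by rewrite /= (ev_add evP) (ev_mul evP) (ev_int evP) ev_sym_exp Z_of_intK big_cons IH.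
Qed.

End SymbolicFox.

(** * The test of a table entry and its soundness *)

Section Check.
Variable O : ring_ops.
Implicit Types (t al c : O).

Definition sym_real_s : sym_mx O := (sym0 O, sym1 O, sym1 O, sym0 O).
Definition sym_real_r c : sym_mx O := (sym1 O, c, sym0 O, rint (Zneg xH)).
Definition pos_part (e : int) : nat := if e is Posz n then n else 0%N.
Definition neg_part (e : int) : nat := if e is Negz n then n.+1 else 0%N.

(* f_value times t ^ neg_part e, where e is the exponent of t in f. *)
Definition f_num (l : nat) (f : coef_data) al t : O :=
  let: (sg, e, cs) := f in
  rmul (rmul (rmul (sym_exp (rint (Zneg xH)) sg) (sym_exp t (pos_part e)))
             (sym_exp (radd t (sym1 O)) (l.-1)./2))
       (foldl (fun v h => radd (rmul v al) (sym_poly t h)) (sym0 O) cs).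

(** The map c -> c^2 - 2 sends mu + 1/mu to mu^2 + 1/mu^2, so [cs] has one value for each plane. The
    product of the determinants is compared with (1 - t^2)^m f(t) f(-t), where (1 - t^2)^m comes
    from det(t phi(b) - I). Denominators are cleared: a determinant of size 2 doubles the exponent
    o, and t^k (-t)^k serves f(t) f(-t). *)
Definition check_det l p q (f : coef_data) t al c0 : bool :=
  let m := (l.-1)./2 in
  let cs := traject (fun c => sym_sub (rmul c c) (rint (Zpos (xO xH)))) c0 m in
  let u0 := behead (signs p q) in
  let u1 := behead (signs p (q + 2 * l * p)) in
  let: (o, N) := foldr (fun c y =>
      let: (o, P) := sym_fox_mx_alpha t al sym_real_s (sym_real_r c) u0 u1 in
      ((2 * o + y.1)%N, rmul (mdet P) y.2)) (0%N, sym1 O) cs in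
  let t' := sym_sub (sym0 O) t in
  let k := neg_part f.1.2 in
  iszero (sym_sub (rmul N (rmul (sym_exp t k) (sym_exp t' k)))
    (rmul (rmul (sym_exp t o) (sym_exp (sym_sub (sym1 O) (rmul t t)) m))
          (rmul (f_num l f al t) (f_num l f al t')))).

(** Both letters are the identity, so a diagonal entry gives the Alexander polynomial; the test is
    Delta^m = (t + 1)^m f without denominators. *)
Definition check_mod l p q (f : coef_data) t al : bool :=
  let m := (l.-1)./2 in
  let u0 := behead (signs p q) in
  let u1 := behead (signs p (q + 2 * l * p)) in
  let: (o, (N, _, _, _)) := sym_fox_mx_alpha t al (mone O) (mone O) u0 u1 in
  iszero (sym_sub (rmul (sym_exp N m) (sym_exp t (neg_part f.1.2)))
    (rmul (sym_exp t (o * m)) (rmul (sym_exp (radd t (sym1 O)) m) (f_num l f al t)))).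

End Check.

(* From the minimal polynomial of mu + 1/mu, for mu a primitive l-th root of unity
   and l = 3, 5 or 7. *)
Definition cos_rel (l : nat) : seq Z :=
  if l == 3%N then [:: Zneg xH]
  else if l == 5%N then [:: Zpos xH; Zneg xH]
  else [:: Zpos xH; Zpos (xO xH); Zneg xH].

(** Here t and alpha are independent variables, so one computation covers all k. *)
Definition alpha_poly (O : ring_ops) : ring_ops := poly_ops (@shift_poly O).
Definition t_poly (O : ring_ops) : ring_ops := poly_ops (@shift_poly (alpha_poly O)).
Definition t_var (O : ring_ops) : t_poly O := [:: [::]; [:: rint (Zpos xH)]].
Definition al_var (O : ring_ops) : t_poly O := [:: [:: rint Z0; rint (Zpos xH)]].
Definition cos_ops l : ring_ops :=
  @poly_ops (int_ops Z0) (@shift_quo (int_ops Z0) (cos_rel l)).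
(** Reducing at once matters for l = 3, where c is the constant -1. *)
Definition cos_var l : t_poly (cos_ops l) :=
  [:: [:: @shift_quo (int_ops Z0) (cos_rel l) [:: Zpos xH]]].

(** The third condition, where q / p is a, provides mu^a <> 1 when j may be nonzero. Determinants
    are tested over Z[c], the congruence over the integers modulo l. *)
Definition check (e : (nat * nat * nat * bool) * coef_data) : bool :=
  let: ((l, p, q, star), f) := e in
  [&& l \in [:: 3; 5; 7]%N, odd q, star || ~~ (l %| q %/ p)%N,
    check_det l p q f (t_var (cos_ops l)) (al_var (cos_ops l)) (cos_var l)
  & check_mod l p q f (t_var (int_ops (Z_of_int l))) (al_var (int_ops (Z_of_int l)))].

Lemma check_table : all check table.
Proof. by vm_compute. Qed.

Lemma fox_sum_entry (K : fieldType) (t : K) m n (G : nat -> 'M[K]_(m, n)) i u a b :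
  fox_sum t G i u a b = fox_sum t (fun h => G h a b : K^o) i u.
Proof.
elim: u i => [|[] u IH] i /=; rewrite !mxE // IH //.
  by case: (odd i); rewrite ?mxE.
by case: (odd i); rewrite ?mxE.
Qed.

Lemma fox_mx_trivial (K : fieldType) (t : K) n (i : 'I_n) u :
  fox_mx t 1%:M 1%:M u i i = alex_sum t u.
Proof.
have -> : fox_mx t 1%:M 1%:M u
    = 1%:M + (t - 1) *: fox_sum t (fun=> 1%:M : 'M[K]_n) 1 u.
  rewrite /fox_mx -[X in _ - X]scale1r -scalerBl -scalemxAl mul1mx.
  congr (_ + _ *: _); apply: eq_fox_sum.
  by elim=> //= h ->; rewrite if_same mulmx1.
by rewrite !mxE fox_sum_entry !mxE eqxx.
Qed.

Section CheckSound.
Variables (O : ring_ops) (K : fieldType) (ev : O -> K) (t al : O) (l k : nat).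
Hypotheses (evP : eval_spec ev) (t0 : ev t != 0) (alE : ev al = alpha l k (ev t)).

Lemma ev_f_num f x : ev x != 0 -> ev al = alpha l k (ev x) ->
  ev (f_num l f al x) = f_value l k f (ev x) * ev x ^+ neg_part f.1.2.
Proof.
case: f => [[sg e] cs] x0 alx; rewrite /f_num /f_value !(ev_mul evP) !(ev_sym_exp evP).
rewrite (ev_rintN1 evP) (ev_add evP) (ev_sym1 evP) -alx.
have -> : ev x ^+ pos_part e = ev x ^ e * ev x ^+ neg_part e.
  by case: e => n; rewrite /= ?mulr1 // NegzE -exprnN mulVf // expf_neq0.
have -> : forall v, ev (foldl (fun v h => radd (rmul v al) (sym_poly x h)) v cs)
    = foldl (fun v c => v * ev al + poly_value c (ev x)) (ev v) cs.
  elim: cs => //= h cs IH v.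
  by rewrite IH (ev_add evP) (ev_mul evP) (ev_sym_poly _ evP).
by rewrite (ev_sym0 evP) [RHS]mulrAC mulrA; congr (_ * _); rewrite mulrAC.
Qed.

Definition det_alpha (a t : K) p q c : K :=
  \det ((1 - a) *: fox_mx t (real_s K) (real_r c) (behead (signs p q))
        + a *: fox_mx t (real_s K) (real_r c) (behead (signs p (q + 2 * l * p)))).

Lemma check_det_sound p q f c0 : check_det l p q f t al c0 ->
  \prod_(c <- traject (fun c => c ^+ 2 - 2%:R) (ev c0) (l.-1)./2)
     det_alpha (ev al) (ev t) p q c
  = (1 - ev t ^+ 2) ^+ (l.-1)./2 * f_value l k f (ev t) * f_value l k f (- ev t).
Proof.
rewrite /check_det; set m := (l.-1)./2.
set u0 := behead (signs p q); set u1 := behead (signs p _).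
set F := foldr _ _ _.
have FE : ev F.2 = ev t ^+ F.1 *
    \prod_(c <- traject (fun c => c ^+ 2 - 2%:R) (ev c0) m)
       det_alpha (ev al) (ev t) p q c.
  rewrite /F; elim: m c0 {F} => [|m IH] c0.
    by rewrite big_nil /= mul1r (ev_sym1 evP).
  rewrite big_cons [traject _ _ _]/= [foldr _ _ _]/=.
  have := IH (sym_sub (rmul c0 c0) (rint (Zpos (xO xH)))); set F := foldr _ _ _.
  rewrite (ev_sym_sub evP) (ev_mul evP) (ev_int evP) -expr2 => FE.
  have := @sym_fox_mx_alphaE O t al (sym_real_s O) (sym_real_r c0) K ev evP t0 u0 u1.
  case: (sym_fox_mx_alpha _ _ _ _ _ _) => o P /(_ _)/wrap[].
    rewrite /= (ev_sym0 evP) (ev_sym1 evP) mul_mx2 one_mx2.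
    by congr mx2; ring.
  rewrite /= (ev_sym0 evP) (ev_sym1 evP) (ev_rintN1 evP) => PE.
  rewrite (ev_mul evP) (ev_det evP) PE detZ FE exprD mulnC exprM.
  by rewrite [LHS]mulrACA.
case: F FE => o N /= NE.
move=> /(ev_zero evP); rewrite (ev_sym_sub evP) !(ev_mul evP) NE !(ev_sym_exp evP).
rewrite !(ev_sym_sub evP) (ev_sym0 evP) (ev_sym1 evP) sub0r (ev_mul evP) -expr2.
(* As alpha_k is even in t, the same symbol represents it in f(-t). *)
have alN : ev al = alpha l k (- ev t).
  by rewrite alE /alpha -!mulnA !(exprM (- ev t)) sqrrN !(exprM (ev t)).
rewrite !ev_f_num ?(ev_sym_sub evP) ?(ev_sym0 evP) ?sub0r ?oppr_eq0 //.
set n := neg_part _; set fp := f_value _ _ _ _; set fm := f_value _ _ _ _.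
move/eqP; rewrite subr_eq0 => /eqP.
have to : ev t ^+ o * (ev t ^+ n * (- ev t) ^+ n) != 0.
  by rewrite !mulf_neq0 ?expf_neq0 ?oppr_eq0.
move=> eqN; apply: (mulfI to).
by rewrite [LHS]mulrAC eqN; ring.
Qed.

Lemma check_mod_sound p q f : check_mod l p q f t al ->
  ((1 - ev al) * alex_sum (ev t) (behead (signs p q))
    + ev al * alex_sum (ev t) (behead (signs p (q + 2 * l * p)))) ^+ (l.-1)./2
  = (ev t + 1) ^+ (l.-1)./2 * f_value l k f (ev t).
Proof.
rewrite /check_mod.
have := @sym_fox_mx_alphaE O t al (mone O) (mone O) K ev evP t0
  (behead (signs p q)) (behead (signs p (q + 2 * l * p))).
case: (sym_fox_mx_alpha _ _ _ _ _ _) => o [[[N a] b] c] /(_ _)/wrap[].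
  by rewrite !mev_one // mulmx1.
rewrite !mev_one // => /(congr1 (fun M : 'M_2 => M 0 0)).
have ent (x y z : K) (M1 M2 : 'M_2) :
    (x *: (y *: M1 + z *: M2)) 0 0 = x * (y * M1 0 0 + z * M2 0 0) by rewrite !mxE.
rewrite ent !fox_mx_trivial mxE /= => NE.
move=> /(ev_zero evP) /eqP; rewrite (ev_sym_sub evP) !(ev_mul evP) !(ev_sym_exp evP).
rewrite subr_eq0 NE (ev_add evP) (ev_sym1 evP) ev_f_num // exprMn -exprM => /eqP.
move: (_ + ev al * _) => M; set n := neg_part _; set fv := f_value _ _ _ _ => eqM.
have to : ev t ^+ (o * (l.-1)./2) * ev t ^+ n != 0 by rewrite mulf_neq0 ?expf_neq0.
by apply: (mulfI to); rewrite [LHS]mulrAC eqM; ring.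
Qed.
End CheckSound.

(** * Decomposition of the representation of dimension l *)

Lemma unity_neq0 (K : fieldType) l (z : K) : (0 < l)%N -> z ^+ l = 1 -> z != 0.
Proof.
by move=> l0; apply: contra_eq_neq => ->; rewrite expr0n gtn_eqF // eq_sym oner_eq0.
Qed.

Section EvalSpecs.
Variables (K : fieldType) (al t : K).

Definition t_poly_ev (O : ring_ops) (ev : O -> K) : t_poly O -> K :=
  @pev (alpha_poly O) K (pev ev al) t.

Lemma t_poly_spec (O : ring_ops) (ev : O -> K) : eval_spec ev -> eval_spec (t_poly_ev ev).
Proof.
move=> evP; have alP : @eval_spec (alpha_poly O) K (pev ev al).
  by apply: poly_ops_spec => // u; exact: shift_polyE.
by apply: poly_ops_spec => // u; exact: (shift_polyE _ _ alP).
Qed.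

Lemma t_var_ev (O : ring_ops) (ev : O -> K) : eval_spec ev -> t_poly_ev ev (t_var O) = t.
Proof. by move=> evP; rewrite /= (ev_int evP) !mulr0 !addr0 add0r mulr1. Qed.

Lemma al_var_ev (O : ring_ops) (ev : O -> K) :
  eval_spec ev -> t_poly_ev ev (al_var O) = al.
Proof. by move=> evP; rewrite /= !(ev_int evP) !mulr0 !addr0 mulr1 add0r. Qed.

Variables (l : nat) (mu : K).
Hypotheses (l357 : l \in [:: 3; 5; 7]%N) (mul1 : mu ^+ l = 1) (mu1 : mu != 1).

Let mu0 : mu != 0.
Proof.
by apply: unity_neq0 mul1; case: l l357.
Qed.

(** Dividing 1 + mu + ... + mu^(l-1) = 0 by mu^((l-1)/2) gives a relation in mu + 1/mu. *)
Lemma cos_relE : @pev (int_ops Z0) K (int_ev K) (mu + mu^-1) (cos_rel l)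
  = (mu + mu^-1) ^+ size (cos_rel l).
Proof.
have /eqP := subrX1 mu l; rewrite mul1 subrr eq_sym mulf_eq0 subr_eq0 (negbTE mu1).
move=> /eqP; set c := mu + mu^-1; set e := int_ev K.
have e1 : e (Zpos xH) = 1 by [].
have eN1 : e (Zneg xH) = -1 by [].
have e2 : e (Zpos (xO xH)) = 2%:R by [].
move: l357; rewrite !inE => /or3P[] /eqP ->; rewrite /pev /= ?e1 ?eN1 ?e2;
  rewrite !big_ord_recr big_ord0 /= => sum0; apply/eqP; rewrite -subr_eq0; apply/eqP.
- transitivity (- (0 + mu ^+ 0 + mu ^+ 1 + mu ^+ 2) / mu); last first.
    by rewrite sum0 oppr0 mul0r.
  by rewrite /c; field.
- transitivity (- (0 + mu ^+ 0 + mu ^+ 1 + mu ^+ 2 + mu ^+ 3 + mu ^+ 4) / mu ^+ 2);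
    last by rewrite sum0 oppr0 mul0r.
  by rewrite /c; field.
- transitivity (- (0 + mu ^+ 0 + mu ^+ 1 + mu ^+ 2 + mu ^+ 3 + mu ^+ 4 + mu ^+ 5
                   + mu ^+ 6) / mu ^+ 3); last by rewrite sum0 oppr0 mul0r.
  by rewrite /c; field.
Qed.

Definition cos_ev : cos_ops l -> K := @pev (int_ops Z0) K (int_ev K) (mu + mu^-1).

Lemma cos_rel_size : (0 < size (cos_rel l))%N.
Proof. by move: l357; rewrite !inE => /or3P[] /eqP ->. Qed.

Lemma cos_ev_spec : eval_spec cos_ev.
Proof.
apply: poly_ops_spec; first exact: int_ops_spec.
move=> u; apply: shift_quoE; [exact: int_ops_spec | exact: cos_rel_size |].
exact: cos_relE.
Qed.

Lemma cos_var_ev : t_poly_ev cos_ev (cos_var l) = mu + mu^-1.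
Proof.
rewrite /t_poly_ev /cos_var; set x := shift_quo _ _.
rewrite [LHS]/= !mulr0 !addr0 /cos_ev (@shift_quoE (int_ops Z0) K _ _ (cos_rel l)).
- by rewrite /= mulr0 addr0 mulr1.
- exact: int_ops_spec.
- exact: cos_rel_size.
- exact: cos_relE.
Qed.

End EvalSpecs.

Section Decomposition.
Variables (K : fieldType) (l : nat).

(** For z^l = 1, a left eigenvector of the shift with eigenvalue z. *)
Definition pow_row (z : K) : 'rV[K]_l := \row_i z ^+ i.

Lemma pow_row_shift z : z ^+ l = 1 -> pow_row z *m shift_mx K l = z *: pow_row z.
Proof.
move=> zl; apply/rowP => j; rewrite !mxE.
case: (ltnP j.+1 l) => jl.
  rewrite (bigD1 (Ordinal jl)) //= big1 ?addr0; last first.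
    move=> i; rewrite -val_eqE /= => /negbTE ij; rewrite !mxE ij /=.
    have /negbTE -> : j != l.-1 :> nat by lia.
    by rewrite andbF mulr0.
  by rewrite !mxE eqxx /= mulr1 exprS.
have l0 : (0 < l)%N := leq_ltn_trans (leq0n j) (ltn_ord j).
have jE : j = l.-1 :> nat by have := ltn_ord j; lia.
rewrite (bigD1 (Ordinal l0)) //= big1 ?addr0; last first.
  move=> i; rewrite -val_eqE /= => /negbTE i0; rewrite !mxE i0 /= orbF.
  by rewrite (_ : (i == j.+1 :> nat) = false) ?mulr0 //; have := ltn_ord i; lia.
by rewrite !mxE jE !eqxx orbT mulr1 expr0 -exprS prednK.
Qed.

Lemma pow_row_flip z : z ^+ l = 1 -> pow_row z *m flip_mx K l = z^-1 *: pow_row z^-1.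
Proof.
move=> zl; apply/rowP => j; rewrite !mxE (bigD1 (rev_ord j)) //= big1 ?addr0.
  have jl := ltn_ord j; rewrite !mxE /=.
  have -> : (l - j.+1 + j == l.-1)%N by lia.
  have z0 : z != 0 := unity_neq0 (leq_ltn_trans (leq0n j) jl) zl.
  have zj : z ^+ j.+1 != 0 by rewrite expf_neq0.
  apply: (mulIf zj); rewrite mulr1 -exprD subnK // zl exprVn exprS.
  by field; rewrite z0 expf_neq0.
move=> i; rewrite -val_eqE /= => ij; rewrite !mxE.
rewrite (_ : (i + j == l.-1)%N = false) ?mulr0 //.
by apply/negbTE; apply: contra ij => /eqP ij; apply/eqP; have := ltn_ord j; lia.
Qed.

Lemma pow_row_shiftX z n : z ^+ l = 1 ->
  pow_row z *m shift_mx K l ^+ n = z ^+ n *: pow_row z.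
Proof.
move=> zl; elim: n => [|n IH]; first by rewrite !expr0 mulmx1 scale1r.
by rewrite exprSr -mulmxE mulmxA IH -scalemxAl pow_row_shift // scalerA -exprSr.
Qed.

Definition refl (u : nat) : 'M[K]_l := flip_mx K l *m shift_mx K l ^+ u.

Lemma pow_row_refl z u : z ^+ l = 1 ->
  pow_row z *m refl u = (z^-1 * z^-1 ^+ u) *: pow_row z^-1.
Proof.
move=> zl; rewrite mulmxA pow_row_flip // -scalemxAl pow_row_shiftX ?scalerA //.
by rewrite exprVn zl invr1.
Qed.

(** With the image under [refl u] as second row, [refl u] swaps the rows and acts as [diag_r]
    without scalars. *)
Definition plane u z : 'M[K]_(2, l) :=
  \matrix_(i < 2) if i == 0 then pow_row z else pow_row z *m refl u.

Lemma mx2_plane a b c d u z : mx2 a b c d *m plane u z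
  = \matrix_(i < 2) if i == 0 then a *: pow_row z + b *: (pow_row z *m refl u)
                    else c *: pow_row z + d *: (pow_row z *m refl u).
Proof.
apply/row_matrixP => i; rewrite row_mul mulmx_sum_row !big_ord_recl big_ord0 addr0.
by rewrite !rowK !mxE /=; case: (i == 0).
Qed.

Hypothesis l0 : (0 < l)%N.


Lemma pow_row_refl2 z u v : z ^+ l = 1 ->
  pow_row z *m refl u *m refl v = (z ^+ v / z ^+ u) *: pow_row z.
Proof.
move=> zl; have z0 := unity_neq0 l0 zl.
rewrite pow_row_refl // -scalemxAl pow_row_refl ?exprVn ?zl ?invr1 // invrK scalerA.
by congr (_ *: _); field; rewrite z0 oner_eq0 !expf_neq0.
Qed.

Lemma plane_r z v : z ^+ l = 1 -> plane v z *m refl v = diag_r K *m plane v z.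
Proof.
move=> zl; have z0 := unity_neq0 l0 zl.
rewrite mx2_plane !scale0r !scale1r addr0 add0r.
apply/row_matrixP => i; rewrite row_mul !rowK; case: (i == 0) => //.
by rewrite pow_row_refl2 // divff ?expf_neq0 // scale1r.
Qed.

Lemma plane_s z u v : z ^+ l = 1 ->
  plane v z *m refl u = diag_s (z ^+ v / z ^+ u) *m plane v z.
Proof.
move=> zl; have z0 := unity_neq0 l0 zl.
rewrite mx2_plane !scale0r addr0 add0r.
apply/row_matrixP => i; rewrite row_mul !rowK; case: (i == 0).
  rewrite !pow_row_refl // scalerA; congr (_ *: _); rewrite !exprVn.
  by field; rewrite z0 ?oner_eq0 !expf_neq0.
by rewrite pow_row_refl2 // invfM invrK mulrC.
Qed.

Lemma pow_row1_refl u : pow_row 1 *m refl u = pow_row 1.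
Proof. by rewrite pow_row_refl ?expr1n // invr1 expr1n mulr1 scale1r. Qed.

Section Stack.
Variables (v : nat) (z_ : nat -> K).

(** This is 2m + 1, by recursion so that the block matrices have matching types. *)
Fixpoint stack_dim (m : nat) : nat := if m is m'.+1 then (2 + stack_dim m')%N else 1%N.

Fixpoint stack (m : nat) : 'M[K]_(stack_dim m, l) :=
  if m is m'.+1 then col_mx (plane v (z_ m')) (stack m') else pow_row 1.

Fixpoint block_diag (M : 'M[K]_1) (f : nat -> 'M[K]_2) (m : nat) : 'M[K]_(stack_dim m) :=
  if m is m'.+1 then block_mx (f m') 0 0 (block_diag M f m') else M.

Lemma stack_mul m X M f : pow_row 1 *m X = M *m pow_row 1 ->
    (forall i, plane v (z_ i) *m X = f i *m plane v (z_ i)) ->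
  stack m *m X = block_diag M f m *m stack m.
Proof.
move=> M1 fi; elim: m => //= m IH.
by rewrite mul_col_mx fi IH mul_block_col !mul0mx addr0 add0r.
Qed.

Lemma det_block_diag M f m :
  \det (block_diag M f m) = \det M * \prod_(i < m) \det (f i).
Proof.
elim: m => [|m IH] /=; first by rewrite big_ord0 mulr1.
by rewrite det_ublock IH big_ord_recr /= mulrC mulrA.
Qed.

Lemma pow_row1_stack m : (pow_row 1 <= stack m)%MS.
Proof.
elim: m => [|m IH] //=.
by apply: submx_trans IH _; rewrite -addsmxE addsmxSr.
Qed.

Lemma pow_row_stack m i : (i < m)%N -> z_ i ^+ l = 1 ->
  (pow_row (z_ i) <= stack m)%MS /\ (pow_row (z_ i)^-1 <= stack m)%MS.
Proof.
move=> im zl; have z0 := unity_neq0 l0 zl.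
have [zP zVP] : (pow_row (z_ i) <= plane v (z_ i))%MS
    /\ (pow_row (z_ i)^-1 <= plane v (z_ i))%MS.
  split; first by have := row_sub 0 (plane v (z_ i)); rewrite rowK.
  have c0 : (z_ i)^-1 * (z_ i)^-1 ^+ v != 0 by rewrite mulf_neq0 ?expf_neq0 ?invr_eq0.
  rewrite -(eqmx_scale (pow_row _) c0) -pow_row_refl //.
  by have := row_sub 1 (plane v (z_ i)); rewrite rowK.
suff sub_stack : (plane v (z_ i) <= stack m)%MS.
  by split; [exact: submx_trans zP _ | exact: submx_trans zVP _].
elim: m im => // m IH; rewrite ltnS leq_eqVlt => /predU1P[->|/IH im] /=.
  by rewrite -addsmxE addsmxSl.
by apply: submx_trans im _; rewrite -addsmxE addsmxSr.
Qed.

End Stack.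

(** Once the stack is invertible, it conjugates [X] to a block diagonal matrix. *)
Lemma det_stack m v (z_ : nat -> K) zeta X M f :
    stack_dim m = l -> l.-primitive_root zeta -> (forall i, (z_ i) ^+ l = 1) ->
    (forall i, (i < l)%N -> zeta ^+ i = 1 \/
       exists2 h, (h < m)%N & zeta ^+ i = z_ h \/ zeta ^+ i = (z_ h)^-1) ->
    pow_row 1 *m X = M *m pow_row 1 ->
    (forall i, plane v (z_ i) *m X = f i *m plane v (z_ i)) ->
  \det X = \det M * \prod_(i < m) \det (f i).
Proof.
move=> dim_m zeta_prim zl cover XM Xf.
rewrite -det_block_diag; have := stack_mul m XM Xf.
suff: row_full (stack v z_ m).
  move: (stack v z_ m) (block_diag M f m); rewrite dim_m => V D.
  rewrite row_full_unit unitmxE unitfE => V0 /(congr1 determinant).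
  by rewrite !det_mulmx mulrC => /(mulIf V0).
(* The rows of [W] are the eigenvectors for the distinct powers of zeta; by [cover] they all lie in
   the row space of the stack. *)
pose W := (Vandermonde l (\row_(i < l) zeta ^+ i))^T.
have W_unit : W \in unitmx.
  rewrite unitmx_tr unitmxE unitfE det_Vandermonde.
  apply/prodf_neq0 => i _; apply/prodf_neq0 => j ij.
  rewrite !mxE subr_eq0 (eq_prim_root_expr zeta_prim).
  by rewrite !modn_small // eq_sym neq_ltn ij.
rewrite -sub1mx; apply: submx_trans (_ : W <= _)%MS.
  by rewrite sub1mx row_full_unit.
apply/row_subP => i; have -> : row i W = pow_row (zeta ^+ i).
  by apply/rowP => j; rewrite !mxE.
case: (cover i (ltn_ord i)) => [->|[h hm]]; first exact: pow_row1_stack.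
by have [zP zVP] := pow_row_stack v hm (zl h); case=> ->.
Qed.

End Decomposition.

(** * Representations of the dihedral group *)

Section Roots.

Lemma prime_primitive_root (K : fieldType) l (z : K) :
  prime l -> z ^+ l = 1 -> z != 1 -> l.-primitive_root z.
Proof.
move=> l_pr zl z1; have [m m_prim m_dvd] := prim_order_exists (prime_gt0 l_pr) zl.
case/primeP: l_pr => _ /(_ _ m_dvd) /orP[] /eqP mE; last by rewrite -mE.
by have := prim_expr_order m_prim; rewrite mE expr1 => zE; rewrite zE eqxx in z1.
Qed.

(** A root of 1 + X + ... + X^(l-1) is not 1, where the value is l <> 0. *)
Lemma exists_primitive_root (R : realType) l :
  prime l -> exists z : R[i], l.-primitive_root z.
Proof.
move=> l_pr; have l0 := prime_gt0 l_pr.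
have /closed_rootP[z] : size (\sum_(i < l) 'X^i : {poly R[i]}) != 1%N.
  have -> : \sum_(i < l) 'X^i = \poly_(i < l) (1 : R[i]).
    by rewrite poly_def; apply: eq_bigr => i _; rewrite scale1r.
  by rewrite size_poly_eq ?oner_neq0 // neq_ltn prime_gt1 // orbT.
rewrite /root horner_sum => /eqP sum0.
have zl : z ^+ l = 1.
  apply/eqP; rewrite -subr_eq0 subrX1.
  rewrite (_ : \sum_(i < l) z ^+ i = 0) ?mulr0 //; apply: etrans sum0.
  by apply: eq_bigr => i _; rewrite hornerXn.
exists z; apply: prime_primitive_root => //; apply: contra_eq_neq sum0 => ->.
under eq_bigr => i _ do rewrite hornerXn expr1n.
by rewrite sumr_const card_ord pnatr_eq0 -lt0n.
Qed.

End Roots.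

(** * Matrices of words and images of the knot generators *)

Section PresentedRep.
Variables (F : fieldType) (n : nat) (rels : seq (word * word)).
Variable phi : presented rels -> 'M[F]_n.
Hypothesis phiP : is_representation phi.

Lemma pword_cons x u : pword rels (x :: u) = (pword rels [:: x] * pword rels u)%g.
Proof.
apply/pwordP; apply: weq_sym.
exact: (weq_cat (weq_repr rels [:: x]) (weq_repr rels u)).
Qed.

Lemma rep_letter_inv g :
  phi (pword rels [:: (g, true)]) *m phi (pword rels [:: (g, false)]) = 1%:M.
Proof.
case: phiP => phi1 phiM; rewrite -phiM -pword_cons -phi1; congr phi.
apply/pwordP; exact: (weq_cancel rels [::] [::] g true).
Qed.

Lemma rep_word u : phi (pword rels u)
  = eval_word (phi (pgen rels true)) (phi (pgen rels false)) u.
Proof.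
case: phiP => phi1 phiM; elim: u => [|[g s] u IH]; first exact: phi1.
rewrite pword_cons phiM IH /=; congr (_ *m _).
case: s; first by case: g.
have inv := rep_letter_inv g; have [U _] := mulmx1_unit inv.
rewrite /eval_letter /= -[LHS](mulKmx U) inv mulmx1.
by case: g {inv U}.
Qed.

Lemma rep_rel u v : (u, v) \in rels ->
  eval_word (phi (pgen rels true)) (phi (pgen rels false)) u
  = eval_word (phi (pgen rels true)) (phi (pgen rels false)) v.
Proof.
move=> uv; rewrite -!rep_word; congr phi; apply/pwordP.
by have := weq_rel [::] [::] uv; rewrite !cats0.
Qed.

Lemma rep_surj_word (g : presented rels) : exists u, g = pword rels u.
Proof. by exists (repr g); rewrite /pword reprK. Qed.

End PresentedRep.

Section DihedralWords.
Variables (F : fieldType) (l : nat) (zeta : F).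
Hypotheses (l2 : (2 < l)%N) (zeta_prim : l.-primitive_root zeta).
Let f := flip_mx F l.
Let h := shift_mx F l.
Hypotheses (ff : f * f = 1) (hl : h ^+ l = 1) (hfh : h * f * h = f).

Let l_pred : l.-1.+1 = l.
Proof. by rewrite prednK // (ltn_trans _ l2). Qed.

(** The type is [true] for reflections and [false] for rotations. *)
Definition dih_type (b : bool) (M : 'M[F]_l) : Prop :=
  exists n, M = (if b then f else 1) * h ^+ n.

Lemma expr_shift_inv k : h ^+ k * h ^+ (k * l.-1) = 1.
Proof. by rewrite -exprD -mulnS l_pred mulnC exprM hl expr1n. Qed.

Lemma shift_flip k : h ^+ k * f = f * h ^+ (k * l.-1).
Proof.
have hh : h * f = f * h ^+ l.-1 by rewrite -[in RHS]hfh -mulrA -exprS l_pred hl mulr1.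
elim: k => [|k IH]; first by rewrite mul0n !expr0 mulr1 mul1r.
by rewrite exprS -mulrA IH mulrA hh -mulrA -exprD.
Qed.

Lemma dih_typeM b b' M N : dih_type b M -> dih_type b' N -> dih_type (b (+) b') (M * N).
Proof.
case=> m -> [n ->]; case: b'; last first.
  by exists (m + n)%N; rewrite addbF mul1r exprD mulrA.
exists (m * l.-1 + n)%N; rewrite addbT exprD mulrA -mulrA.
rewrite -[_ * h ^+ m * _]mulrA [h ^+ m * _]mulrA shift_flip !mulrA.
by case: b; rewrite /= ?ff ?mul1r.
Qed.

Lemma invmx_right (M N : 'M[F]_l) : M * N = 1 -> invmx M = N.
Proof.
rewrite -mulmxE => MN; have [U _] := mulmx1_unit MN.
by rewrite -[RHS](mulKmx U) MN mulmx1.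
Qed.

Lemma dih_invol n : (f * h ^+ n) * (f * h ^+ n) = 1.
Proof.
rewrite mulrA -[f * h ^+ n * f]mulrA shift_flip mulrA ff mul1r.
by rewrite -exprD addnC exprD expr_shift_inv.
Qed.

Lemma dih_typeV b M : dih_type b M -> dih_type b (invmx M).
Proof.
move=> [n ->]; case: b.
  by exists n; apply: invmx_right; exact: dih_invol.
by exists (n * l.-1)%N; apply: invmx_right; rewrite !mul1r expr_shift_inv.
Qed.

Lemma dih_type_word A B ba bb u : dih_type ba A -> dih_type bb B ->
  exists2 b, dih_type b (eval_word A B u) & (ba || bb = false -> b = false).
Proof.
move=> Ab Bb; elim: u => [|[g s] u [b IH bE]].
  by exists false => //; exists 0%N; rewrite expr0 mulr1.
have X : dih_type (if g then ba else bb) (eval_letter A B (g, s)).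
  by rewrite /eval_letter /=; case: g; case: s => //; exact: dih_typeV.
exists ((if g then ba else bb) (+) b); first by rewrite /= mulmxE; exact: dih_typeM.
move=> ab; rewrite bE // addbF; by case: g ba bb ab {X Ab Bb bE} => -[] [].
Qed.

(** Its eigenvalue zeta^2 is not 1 as l > 2. *)
Lemma shift2_neq1 : h ^+ 2 != 1.
Proof.
apply/eqP => h2; have := pow_row_shiftX 2 (prim_expr_order zeta_prim).
rewrite -/h h2 mulmx1 => /rowP/(_ (Ordinal (ltn_trans (isT : (0 < 2)%N) l2))).
rewrite !mxE expr0 mulr1 => /esym/eqP; rewrite -(prim_order_dvd zeta_prim).
by move=> /dvdn_leq => /(_ isT); rewrite leqNgt l2.
Qed.

(** Otherwise f would be a power of h, commute with h, and h f h = f would give h^2 = 1. *)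
Lemma dih_type_excl M : dih_type true M -> dih_type false M -> False.
Proof.
move=> [m ->] [n]; rewrite mul1r => fhE.
have {fhE} fE : f = h ^+ (n + m * l.-1).
  by rewrite exprD -fhE -mulrA expr_shift_inv mulr1.
move: (n + _)%N fE => k fE; move/eqP: shift2_neq1; apply.
have hk : h ^+ 2 * h ^+ k = h ^+ k.
  by rewrite -exprD -[RHS]fE -hfh fE -exprS -exprSr.
by rewrite -[LHS]mulr1 -ff [in X in _ * X]fE mulrA hk -fE.
Qed.

(* An epimorphism onto the dihedral group maps a and b, which are conjugate,
   to distinct reflections. *)
Lemma dihedral_letters A B w :
    (exists b, dih_type b A) -> (exists b, dih_type b B) ->
    A *m eval_word A B w = eval_word A B w *m B ->
    (exists u, f = eval_word A B u) -> (exists u, h = eval_word A B u) ->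
  exists u v, [/\ A = f * h ^+ u, B = f * h ^+ v & u != v %[mod l]].
Proof.
move=> [ba Aa] [bb Bb] AWB [x fE] [y hE].
have ftype : dih_type true f by exists 0%N; rewrite expr0 mulr1.
have htype : dih_type false h by exists 1%N; rewrite expr1 mul1r.
have [bw Wb _] := dih_type_word w Aa Bb.
(* Types multiply like signs, so the type of w cancels in A w = w B. *)
have bab : ba = bb.
  have := dih_typeM Aa Wb; have := dih_typeM Wb Bb; rewrite -!mulmxE -AWB addbC.
  by case: ba bb bw {Aa Bb Wb} => -[] [] //= H1 H2;
     first [case: (dih_type_excl H1 H2) | case: (dih_type_excl H2 H1)].
case: ba Aa bab => [Aa bbE|Aa bbE]; last first.
  (* Two rotations generate only rotations, but f is a reflection. *)
  have [b fb] := dih_type_word x Aa Bb; rewrite -bbE => /(_ erefl) b0.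
  by rewrite -fE b0 in fb; case: (dih_type_excl ftype fb).
move: Bb; rewrite -bbE => -[v BE]; case: Aa => u AE; exists u, v; split=> //.
(* If the two reflections agree, every word gives 1 or A, and h is neither. *)
apply/eqP => uv; have AB : A = B.
  rewrite AE BE -(expr_mod u hl) -(expr_mod v hl) uv //.
have AA : A * A = 1 by rewrite AE dih_invol.
have Ainv : invmx A = A by exact: invmx_right.
have [yE|yE] : h = 1 \/ h = A.
  rewrite hE; elim: y {hE} => [|[g s] y IH] /=; first by left.
  have -> : eval_letter A B (g, s) = A.
    by rewrite /eval_letter /= -AB if_same; case: s.
  by case: IH => ->; rewrite mulmxE; [right; rewrite mulr1 | left].
  by move/eqP: shift2_neq1; apply; rewrite yE expr1n.
by apply: (@dih_type_excl h) => //; exists u; rewrite -AE.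
Qed.

End DihedralWords.

Lemma eval_word_rcons (K : fieldType) n (A B : 'M[K]_n) u x :
  eval_word A B (rcons u x) = eval_word A B u *m eval_letter A B x.
Proof. by elim: u => [|y u IH] /=; rewrite ?mulmx1 ?mul1mx // IH mulmxA. Qed.

Section Epimorphism.
Variables (F : fieldType) (l p q : nat) (zeta : F).
Variables (rho : {multiplicative knot_group p q -> dihedral l})
  (pi : dihedral l -> 'M[F]_l).
Hypotheses (l2 : (2 < l)%N) (zeta_prim : l.-primitive_root zeta)
  (rho_surj : forall d, exists g, rho g = d) (piP : is_representation pi)
  (pix : pi (pgen _ gx) = flip_mx F l) (piy : pi (pgen _ gy) = shift_mx F l).

(** These come from the relations of the dihedral group, which [pi] respects, without computing
    matrix products. *)
Lemma flip_shift_rels :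
  [/\ flip_mx F l * flip_mx F l = 1, shift_mx F l ^+ l = 1
    & shift_mx F l * flip_mx F l * shift_mx F l = flip_mx F l].
Proof.
have rel u v : (u, v) \in [:: ([:: (gx, true); (gx, true)], [::]);
      (nseq l (gy, true), [::]);
      ([:: (gy, true); (gx, true)], [:: (gx, true); (gy, false)])] ->
    eval_word (flip_mx F l) (shift_mx F l) u = eval_word (flip_mx F l) (shift_mx F l) v.
  by move=> uv; have := rep_rel piP uv; rewrite pix piy.
have ff : flip_mx F l * flip_mx F l = 1.
  by have := rel _ _ (mem_head _ _); rewrite /= /eval_letter /= !mulmx1.
have hl : shift_mx F l ^+ l = 1.
  have pow n : eval_word (flip_mx F l) (shift_mx F l) (nseq n (gy, true))
      = shift_mx F l ^+ n by elim: n => //= n ->; rewrite exprS.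
  by rewrite -pow; apply: (rel _ [::]); rewrite !inE eqxx orbT.
split=> //.
have := rel [:: (gy, true); (gx, true)] [:: (gx, true); (gy, false)].
rewrite !inE eqxx !orbT => /(_ isT); rewrite /= /eval_letter /= !mulmx1 => hf.
have U : shift_mx F l \in unitmx.
  have hh : shift_mx F l *m shift_mx F l ^+ l.-1 = 1%:M.
    by rewrite mulmxE -exprS prednK ?(ltn_trans _ l2).
  by have [] := mulmx1_unit hh.
by rewrite -!mulmxE hf mulmxKV.
Qed.

Lemma rho_letters : exists u v,
  [/\ pi (rho (pgen _ ga)) = refl F l u, pi (rho (pgen _ gb)) = refl F l v
    & u != v %[mod l]].
Proof.
have [ff hl hfh] := flip_shift_rels.
have phiP : is_representation (pi \o rho).
  case: piP => pi1 piM; split=> [|g h] /=; last by rewrite gmulfM piM.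
  suff -> : rho 1%g = 1%g by [].
  by apply: (@mulgI _ (rho 1%g)); rewrite -gmulfM !mulg1.
have type d : exists b, dih_type b (pi d).
  have [u ->] := rep_surj_word d; rewrite (rep_word piP) pix piy.
  have [||b ? _] := @dih_type_word F l l2 ff hl hfh
    (flip_mx F l) (shift_mx F l) true false u.
  - by exists 0%N; rewrite expr0 mulr1.
  - by exists 1%N; rewrite expr1 mul1r.
  by exists b.
have image d : exists u, pi d = eval_word (pi (rho (pgen _ ga))) (pi (rho (pgen _ gb))) u.
  have [g <-] := rho_surj d; have [u ->] := rep_surj_word g.
  by exists u; rewrite -[LHS]/((pi \o rho) _) (rep_word phiP).
apply: (dihedral_letters l2 zeta_prim ff hl hfh (w := knot_word p q)) => //.
- have := rep_rel phiP (mem_head _ _).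
  by rewrite eval_word_rcons.
- by rewrite -pix.
- by rewrite -piy.
Qed.

End Epimorphism.

(** * Rational functions in t *)

Section Tvar.
Variable F : fieldType.

Lemma tvar_exp_neq1 n : (0 < n)%N -> tvar F ^+ n != 1.
Proof.
move=> n0; rewrite /tvar -tofracXn -tofrac1 tofrac_eq.
apply: contraTneq n0 => /(congr1 (size \o val)) /=.
by rewrite size_polyXn size_poly1 => -[->].
Qed.

Lemma tvar_neq0 : tvar F != 0.
Proof. by rewrite /tvar tofrac_eq0 polyX_eq0. Qed.

Lemma tvar1_neq0 : tvar F + 1 != 0.
Proof.
apply/eqP => t1; have := tvar_exp_neq1 (isT : (0 < 2)%N).
by rewrite -subr_eq0 subr_sqr_1 t1 mulr0 eqxx.
Qed.

Lemma const_fun_is_monoid_morphism : monoid_morphism (@const_fun F).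
Proof. by split=> [|x y]; rewrite /const_fun ?rmorph1 // !rmorphM. Qed.
Lemma const_fun_is_zmod_morphism : zmod_morphism (@const_fun F).
Proof. by move=> x y; rewrite /const_fun !rmorphB. Qed.
HB.instance Definition _ :=
  GRing.isZmodMorphism.Build F (ratfun F) (@const_fun F) const_fun_is_zmod_morphism.
HB.instance Definition _ :=
  GRing.isMonoidMorphism.Build F (ratfun F) (@const_fun F) const_fun_is_monoid_morphism.

Lemma map_refl l u : map_mx (@const_fun F) (refl F l u) = refl (ratfun F) l u.
Proof.
rewrite /refl map_mxM; congr (_ *m _).
  by apply/matrixP => i j; rewrite !mxE rmorph_nat.
have shiftE : map_mx (@const_fun F) (shift_mx F l) = shift_mx (ratfun F) l.
  by apply/matrixP => i j; rewrite !mxE rmorph_nat.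
elim: u => [|u IH]; first by rewrite !expr0 map_mx1.
by rewrite !exprS -!mulmxE map_mxM shiftE IH.
Qed.
End Tvar.

(** * The table *)

Section Determinants.
Variables (K : fieldType) (t zeta : K) (l u v : nat).
Hypotheses (l357 : l \in [:: 3; 5; 7]%N) (t0 : t != 0) (tl1 : t ^+ (2 * l) != 1)
  (zeta_prim : l.-primitive_root zeta) (uv : u != v %[mod l]).

Let l_prime : prime l.
Proof. by move: l357; rewrite !inE => /or3P[] /eqP ->. Qed.
Let l0 : (0 < l)%N := prime_gt0 l_prime.
Let zeta0 : zeta != 0 := unity_neq0 l0 (prim_expr_order zeta_prim).
Let m := (l.-1)./2.
Let mu := zeta ^+ v / zeta ^+ u.

(** Every nonzero residue modulo 3, 5 or 7 is +-2^h with h < (l-1)/2, by enumeration. *)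
Lemma prim_root_cover i : (i < l)%N -> zeta ^+ i = 1 \/
  exists2 h, (h < m)%N &
    zeta ^+ i = zeta ^+ (2 ^ h) \/ zeta ^+ i = (zeta ^+ (2 ^ h))^-1.
Proof.
move=> il; pose ok i := (i == 0%N)
  || has (fun h => (i == 2 ^ h)%N || (i + 2 ^ h == l)%N) (iota 0 m).
have : ok i.
  have all_ok : all ok (iota 0 l).
    by rewrite /ok /m; move: l357; rewrite !inE => /or3P[] /eqP ->.
  by apply: (allP all_ok); rewrite mem_iota.
case/orP=> [/eqP ->|/hasP[h]]; first by left; rewrite expr0.
rewrite mem_iota add0n => /= hm /orP[] /eqP iE; right; exists h => //.
  by left; rewrite iE.
right; apply: (mulIf (expf_neq0 (2 ^ h) zeta0)).
by rewrite -exprD iE (prim_expr_order zeta_prim) mulVf // expf_neq0.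
Qed.

Lemma dim_half : stack_dim m = l.
Proof. by rewrite /m; move: l357; rewrite !inE => /or3P[] /eqP ->. Qed.

Lemma mu_unity : mu ^+ l = 1.
Proof.
by rewrite expr_div_n -!exprM !(mulnC _ l) !exprM (prim_expr_order zeta_prim)
  !expr1n divr1.
Qed.

Lemma mu_prim : l.-primitive_root mu.
Proof.
apply: prime_primitive_root mu_unity _ => //.
rewrite /mu; apply: contraNneq uv => /divr1_eq /eqP.
by rewrite (eq_prim_root_expr zeta_prim) eq_sym.
Qed.

Lemma zeta_unity i : (zeta ^+ i) ^+ l = 1.
Proof. by rewrite -exprM mulnC exprM (prim_expr_order zeta_prim) expr1n. Qed.

(** The trivial summand gives t - 1 and each plane, where b acts as t times a swap, gives 1 -
    t^2. *)
Lemma det_refl_sub1 : \det (t *: refl K l v - 1%:M) = (t - 1) * (1 - t ^+ 2) ^+ m.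
Proof.
rewrite (@det_stack K l l0 m v (fun i => zeta ^+ (2 ^ i)) zeta _
  ((t - 1)%:M) (fun=> t *: diag_r K - 1%:M)) //.
- rewrite det_scalar1 big_const_ord iter_mulr_1; congr (_ * _ ^+ _).
  rewrite /diag_r one_mx2 scale_mx2 -scaleN1r scale_mx2 add_mx2 det_mx2.
  by ring.
- exact: dim_half.
- by move=> i; exact: zeta_unity.
- exact: prim_root_cover.
- rewrite mulmxBr mulmx1 -scalemxAr pow_row1_refl //.
  by rewrite mul_scalar_mx scalerBl scale1r.
- move=> i; rewrite mulmxBr mulmxBl mulmx1 mul1mx -scalemxAr -scalemxAl.
  by rewrite plane_r // zeta_unity.
Qed.

(** On plane i the eigenvalue is mu^(2^i), again primitive since l is odd; its a-th power is not 1
    when l does not divide a. *)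
Lemma det_fox_refl p r a j k :
    (0 < r < p)%N -> j = 0%N \/ ~~ (l %| a)%N ->
    let s := behead (signs (p + 2 * l * j * r)
                       ((a + 2 * l * k) * (p + 2 * l * j * r) + r)) in
  \det (fox_mx t (refl K l u) (refl K l v) s)
  = alex_sum t s * \prod_(i < m)
      det_alpha l (alpha l k t) t p (a * p + r) (mu ^+ (2 ^ i) + (mu ^+ (2 ^ i))^-1).
Proof.
move=> rp ja s; pose mu_ i := mu ^+ (2 ^ i).
rewrite (@det_stack K l l0 m v (fun i => zeta ^+ (2 ^ i)) zeta _
  (fox_mx t 1%:M 1%:M s) (fun i => fox_mx t (diag_s (mu_ i)) (diag_r K) s)) //.
- rewrite det_mx11 fox_mx_trivial; congr (_ * _); apply: eq_bigr => i _.
  have l_odd : odd l by move: l357; rewrite !inE => /or3P[] /eqP ->.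
  have mu_l : mu_ i ^+ l = 1 by rewrite -exprM mulnC exprM mu_unity expr1n.
  have mu_a b : ~~ (l %| b)%N -> mu_ i ^+ b != 1.
    move=> lb; rewrite -exprM -(prim_order_dvd mu_prim) Euclid_dvdM // negb_or lb andbT.
    rewrite Euclid_dvdX // negb_and.
    by move: l357; rewrite !inE => /or3P[] /eqP ->.
  rewrite (det_fox_mx2 t0 tl1 mu_l) //.
  - by rewrite /det_alpha mulnDl addnAC.
  - by rewrite -[mu_ i]expr1 mu_a // dvdn1 gtn_eqF // prime_gt1.
  - by case: ja => [->|/mu_a]; [left | right].
- exact: dim_half.
- by move=> i; exact: zeta_unity.
- exact: prim_root_cover.
- by apply: fox_mx_conj; rewrite mul1mx pow_row1_refl.
- move=> i; apply: fox_mx_conj; last by rewrite plane_r // zeta_unity.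
  rewrite plane_s ?zeta_unity // /mu_ /mu expr_div_n.
  by rewrite -!exprM ![(_ * 2 ^ i)%N]mulnC.
Qed.

Lemma traject_cos : 
  traject (fun c => c ^+ 2 - 2%:R) (mu + mu^-1) m
  = [seq mu ^+ (2 ^ i) + (mu ^+ (2 ^ i))^-1 | i <- iota 0 m].
Proof.
have mu0 : mu != 0 := unity_neq0 l0 mu_unity.
pose c_ i := mu ^+ (2 ^ i) + (mu ^+ (2 ^ i))^-1.
suff gen n i : traject (fun c => c ^+ 2 - 2%:R) (c_ i) n = [seq c_ h | h <- iota i n].
  exact: gen m 0%N.
elim: n i => //= n IH i; congr (_ :: _); rewrite -IH; congr traject.
have x0 : mu ^+ (2 ^ i) != 0 by rewrite expf_neq0.
by rewrite /c_ expnSr exprM; field.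
Qed.
End Determinants.

Lemma table_check e : e \in table -> check e.
Proof. exact: (allP check_table). Qed.

Lemma int_ev_nat (K : fieldType) (n : nat) : int_ev K (Z_of_int n) = n%:R.
Proof. by rewrite /int_ev Z_of_intK. Qed.

(** The formula will hold exactly, with factor 1. *)
Lemma doteq_eq (F : fieldType) l (f g : ratfun F) : f = g -> doteq l f g.
Proof. by move=> ->; exists false, 0; rewrite mul0r expr0z !mul1r. Qed.

Lemma twisted_alexanderE (F : fieldType) (l p q u v : nat)
    (phi : knot_group p q -> 'M[F]_l) :
    phi (pgen _ ga) = refl F l u -> phi (pgen _ gb) = refl F l v ->
    (forall w, refl F l w *m refl F l w = 1%:M) ->
  twisted_alexander phi
  = \det (fox_mx (tvar F) (refl (ratfun F) l u) (refl (ratfun F) l v)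
            (behead (signs p q)))
    / \det (tvar F *: refl (ratfun F) l v - 1%:M).
Proof.
move=> Aa Bb rr; rewrite /twisted_alexander Aa Bb !map_refl.
have rrK w : refl (ratfun F) l w *m refl (ratfun F) l w = 1%:M.
  by rewrite -map_refl -map_mxM rr map_mx1.
by rewrite (fox_knot_word (tvar_neq0 F) (rrK u) (rrK v)).
Qed.

(** * Both claims for one table entry *)

Section TableEntry.
Variables (l p q : nat) (star : bool) (f : coef_data) (a r k j : nat).
Hypotheses (chk : check ((l, p, q, star), f)) (qE : q = (a * p + r)%N)
  (rp : (0 < r < p)%N) (star_j : star -> j = 0%N).

Let p' := (p + 2 * l * j * r)%N.
Let q' := ((a + 2 * l * k) * p' + r)%N.
Let m := (l.-1)./2.

Let l357 : l \in [:: 3; 5; 7]%N.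
Proof. by case/and5P: chk. Qed.

Let l_prime : prime l.
Proof. by move: l357; rewrite !inE => /or3P[] /eqP ->. Qed.

Let q'_odd : odd q'.
Proof.
have [_ q_odd _ _ _] := and5P chk.
have -> : q' = (q + 2 * (l * (k * p' + a * j * r)))%N by rewrite /q' /p' qE; lia.
by rewrite oddD oddM addbF.
Qed.

Let ja : j = 0%N \/ ~~ (l %| a)%N.
Proof.
have [_ _ + _ _] := and5P chk; have [r0 r_lt] := andP rp.
rewrite qE divnMDl ?(ltn_trans r0) // divn_small // addn0.
by case: (star) star_j => [->|_] //; [left | right].
Qed.

Lemma table_twisted (K : fieldType) (t zeta : K) u v :
    t != 0 -> t ^+ 2 != 1 -> t ^+ (2 * l) != 1 ->
    l.-primitive_root zeta -> u != v %[mod l] ->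
  \det (fox_mx t (refl K l u) (refl K l v) (behead (signs p' q')))
    / \det (t *: refl K l v - 1%:M)
  = alexander p' q' t / (t - 1) * f_value l k f t * f_value l k f (- t).
Proof.
move=> t0 t2 tl1 zeta_prim uv; have [_ _ _ chk_det _] := and5P chk.
rewrite (det_refl_sub1 t v l357 zeta_prim) (det_fox_refl l357 t0 tl1 zeta_prim uv k rp ja).
rewrite alexanderE //; set s := behead _.
have mu_l := mu_unity u v zeta_prim; have mu_prim := mu_prim l357 zeta_prim uv.
set mu := zeta ^+ v / zeta ^+ u in mu_l mu_prim *.
have mu1 : mu != 1.
  by rewrite -[mu]expr1 -(prim_order_dvd mu_prim) dvdn1 gtn_eqF // prime_gt1.
have cosP := cos_ev_spec l357 mu_l mu1.
have tE := t_var_ev (alpha l k t) t cosP.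
have alE := al_var_ev (alpha l k t) t cosP.
have := @check_det_sound _ _ _ (t_var _) (al_var _) l k
  (t_poly_spec (alpha l k t) t cosP) _ _ p q f (cos_var l).
rewrite tE alE (cos_var_ev _ _ l357 mu_l mu1) => /(_ t0 erefl chk_det).
rewrite (traject_cos u v l357 zeta_prim) big_map.
rewrite -[X in iota 0 X]subn0 -/(index_iota 0 _) big_mkord -/mu -qE => ->.
have t1 : t - 1 != 0.
  by rewrite subr_eq0; apply: contraNneq t2 => ->; rewrite expr1n.
have t2m : (1 - t ^+ 2) ^+ m != 0 by rewrite expf_neq0 // subr_eq0 eq_sym.
by field; rewrite t1 t2m.
Qed.

Lemma table_mod (K : fieldType) (t : K) :
    t != 0 -> t + 1 != 0 -> t ^+ (2 * l) != 1 -> l%:R = 0 :> K ->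
  f_value l k f t = (alexander p' q' t / (t + 1)) ^+ m.
Proof.
move=> t0 t1 tl1 l_K0; have [_ _ _ _ chk_mod] := and5P chk.
have baseP : @eval_spec (int_ops (Z_of_int l)) K (int_ev K).
  by apply: int_ops_spec; rewrite int_ev_nat.
have tE := t_var_ev (alpha l k t) t baseP.
have alE := al_var_ev (alpha l k t) t baseP.
have := @check_mod_sound _ _ _ (t_var _) (al_var _) l k
  (t_poly_spec (alpha l k t) t baseP) _ _ p q f.
rewrite tE alE => /(_ t0 erefl chk_mod).
have -> : (1 - alpha l k t) * alex_sum t (behead (signs p q))
    + alpha l k t * alex_sum t (behead (signs p (q + 2 * l * p))) = alexander p' q' t.
  rewrite alexanderE // /alex_sum.
  have := @fox_sum_signs1 K K^o t (fun=> 1) l a r p j k t0 tl1.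
  (* A sum of l ones is 0 in characteristic l, so the inserted blocks drop out whatever a is. *)
  rewrite -/p' -/q' => -> //; last by right=> i; rewrite sumr_const card_ord.
  by rewrite /GRing.scale /= qE mulnDl addnAC; ring.
by move=> alexE; rewrite expr_div_n alexE mulrC mulKf // expf_neq0.
Qed.

Lemma table_doteq (F : fieldType) (z : F) : l.-primitive_root z ->
  forall (rho : {multiplicative knot_group p' q' -> dihedral l})
      (pi : dihedral l -> 'M[F]_l),
    (forall d, exists g, rho g = d) ->
    is_representation pi ->
    pi (pgen _ gx) = flip_mx _ l -> pi (pgen _ gy) = shift_mx _ l ->
    let t := tvar F in
  doteq l (twisted_alexander (pi \o rho))
    (alexander p' q' t / (t - 1) * f_value l k f t * f_value l k f (- t)).
Proof.
move=> z_prim rho pi rho_surj piP pix piy t.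
have l2 : (2 < l)%N by move: l357; rewrite !inE => /or3P[] /eqP ->.
have [u [v [Aa Bb uv]]] := rho_letters l2 z_prim rho_surj piP pix piy.
(* The determinants live over F(t), where a constant primitive root remains primitive. *)
have zeta_prim : l.-primitive_root (const_fun z) by rewrite fmorph_primitive_root.
have rr w : refl F l w *m refl F l w = 1%:M.
  by have [ff hl hfh] := flip_shift_rels l2 piP pix piy; exact: dih_invol l2 ff hl hfh w.
apply: doteq_eq; rewrite (twisted_alexanderE Aa Bb rr).
apply: (table_twisted _ _ _ zeta_prim uv).
- exact: tvar_neq0.
- exact: tvar_exp_neq1.
- by rewrite tvar_exp_neq1 // muln_gt0 (prime_gt0 l_prime).
Qed.

End TableEntry.

Theorem theorem18 (R : realType) (l p q : nat) (star : bool) (f : coef_data)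
    (a r k j p' q' : nat) :
  ((l, p, q, star), f) \in table ->
  q = (a * p + r)%N -> (0 < r < p)%N ->
  (star -> j = 0%N) ->
  p' = (p + 2 * l * j * r)%N ->
  q' = (q + 2 * l * (k * p + j * a * r + 2 * l * j * k * r))%N ->
  (forall (rho : {multiplicative knot_group p' q' -> dihedral l})
      (pi : dihedral l -> 'M[R[i]]_l),
    (forall d, exists g, rho g = d) ->
    is_representation pi ->
    pi (pgen _ gx) = flip_mx _ l -> pi (pgen _ gy) = shift_mx _ l ->
    let t := tvar R[i] in
    doteq l (twisted_alexander (pi \o rho))
      (alexander p' q' t / (t - 1) * f_value l k f t * f_value l k f (- t))) /\
  (let t := tvar 'F_l in
   f_value l k f t = (alexander p' q' t / (t + 1)) ^+ (l.-1)./2).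
Proof.
move=> /table_check chk qE rp star_j p'E q'E.
(* Division of q' by p' has quotient a + 2lk and the same remainder r. *)
have {}q'E : q' = ((a + 2 * l * k) * p' + r)%N by rewrite q'E p'E qE; nia.
rewrite q'E p'E => {q'E p'E p' q'}.
have l_prime : prime l.
  by have [+ _ _ _ _] := and5P chk; rewrite !inE => /or3P[] /eqP ->.
split.
  have [z z_prim] := exists_primitive_root R l_prime.
  exact: (table_doteq chk qE rp star_j z_prim).
move=> t; apply: (table_mod k chk qE rp star_j).
- exact: tvar_neq0.
- exact: tvar1_neq0.
- by rewrite tvar_exp_neq1 // muln_gt0 (prime_gt0 l_prime).
- by rewrite -(rmorph_nat (@const_fun 'F_l)) pchar_Fp_0 // rmorph0.
Qed.
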